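(* Let $N\geq 2$, $k\in\mathbb{R}$, $\sigma\in\mathbb{R}$. Assume that $f\in L^1(\partial B_1)$ and $I_f:=\int_{\partial B_1} f(x)\,dS_x>0$. If $-1\leq\alpha\leq 0$, $\sigma+2(\alpha+1)>0$ and $k>2-N$, then for all $p$ with $$1<p<1+\frac{\sigma+2(\alpha+1)}{N+k-2}:$$ (i) the problem consisting of the inequality $\partial_t u-\Delta u-k\frac{x}{|x|^2}\cdot\nabla u\geq t^\alpha|x|^\sigma|u|^p$ in $(0,\infty)\times B_1^c$ under the Neumann-type boundary condition $\frac{\partial u}{\partial\nu}(t,x)\geq f(x)$ on $(0,\infty)\times\partial B_1$ admits no global weak solution; (ii) the problem consisting of the same inequality under the Dirichlet-type boundary condition $u(t,x)\geq f(x)$ on $(0,\infty)\times\partial B_1$ admits no global weak solution.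
   Context: $B_1$ is the open unit ball centered at the origin of $\mathbb{R}^N$, $B_1^c$ is its complement in $\mathbb{R}^N$ (a closed set), $\nu$ is the outward unit normal on $\partial B_1$ relative to $B_1^c$ (so $\nu(x)=-x$). Put $\Omega=(0,\infty)\times B_1^c$ and $\Gamma=(0,\infty)\times\partial B_1$; note $\Gamma\subset\Omega$. Solutions are real-valued and may change sign. The notation $\mathrm{supp}(\varphi)\subset\subset\Omega$ means that the support is a compact subset of $\Omega$ (it may meet $\Gamma$). $C^{1,2}_{t,x}(\Omega)$ denotes functions that are $C^1$ in $t$ and $C^2$ in $x$ on $\Omega$. Neumann-type problem. Let $\Phi=\{\varphi\in C^{1,2}_{t,x}(\Omega):\ \varphi\geq 0,\ \mathrm{supp}(\varphi)\subset\subset\Omega,\ (\frac{\partial\varphi}{\partial\nu}+k\varphi)|_\Gamma=0\}$. A global weak solution of the inequality under the Neumann-type boundary condition is a function $u\in L^p_{loc}(\Omega)$ such that for every $\varphi\in\Phi$, $$\int_\Omega t^\alpha|x|^\sigma|u|^p\varphi\,dx\,dt+\int_\Gamma f\varphi\,dS_x\,dt\leq-\int_\Omega u\,\partial_t\varphi\,dx\,dt+\int_\Omega\left(-\Delta\varphi+k\,\mathrm{div}\left(\varphi\frac{x}{|x|^2}\right)\right)u\,dx\,dt.$$ Dirichlet-type problem. Let $\Psi=\{\psi\in C^{1,2}_{t,x}(\Omega):\ \psi\geq 0,\ \mathrm{supp}(\psi)\subset\subset\Omega,\ \psi|_\Gamma=0,\ \frac{\partial\psi}{\partial\nu}|_\Gamma\leq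 0\}$. A global weak solution of the inequality under the Dirichlet-type boundary condition is a function $u\in L^p_{loc}(\Omega)$ such that for every $\psi\in\Psi$, $$\int_\Omega t^\alpha|x|^\sigma|u|^p\psi\,dx\,dt-\int_\Gamma f\frac{\partial\psi}{\partial\nu}\,dS_x\,dt\leq-\int_\Omega u\,\partial_t\psi\,dx\,dt+\int_\Omega\left(-\Delta\psi+k\,\mathrm{div}\left(\psi\frac{x}{|x|^2}\right)\right)u\,dx\,dt.$$ *)

(* Defs.v *)
From HB Require Import structures.
From mathcomp Require Import all_boot all_order all_algebra.
From mathcomp Require Import all_classical all_reals all_analysis.
From mathcomp Require Import measurable_realfun.

Set Implicit Arguments.
Unset Strict Implicit.
Unset Printing Implicit Defensive.

Import Order.TTheory GRing.Theory Num.Theory.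
Import numFieldNormedType.Exports.

Local Open Scope classical_set_scope.
Local Open Scope ring_scope.

(* Product sigma-algebra on row vectors, as the library does for tuples. *)
Definition measure_rV_display : measure_display.
Proof. exact: default_measure_display. Qed.

Section measurable_rV.
Context {R : realType} (n : nat).

Definition rV_coord (i : 'I_n) (x : 'rV[R]_n) : R := x 0 i.

Let rV_set0 : g_sigma_preimage rV_coord set0.
Proof. exact: sigma_algebra0. Qed.

Let rV_setC A : g_sigma_preimage rV_coord A -> g_sigma_preimage rV_coord (~` A).
Proof. exact: sigma_algebraC. Qed.

Let rV_bigcup (F : _^nat) : (forall i, g_sigma_preimage rV_coord (F i)) ->
  g_sigma_preimage rV_coord (\bigcup_i (F i)).
Proof. exact: sigma_algebra_bigcup. Qed.

HB.instance Definition _ := @isMeasurable.Build measure_rV_display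
  'rV[R]_n (g_sigma_preimage rV_coord) rV_set0 rV_setC rV_bigcup.

Lemma measurable_coord (i : 'I_n) :
  measurable_fun [set: 'rV[R]_n] (fun x => x 0 i).
Proof.
move=> _ Y mY; rewrite setTI; apply: sub_sigma_algebra => /=.
rewrite -bigcup_seq/=; exists i => /=; first by rewrite mem_index_enum.
by exists Y => //; rewrite setTI.
Qed.

Lemma measurable_fun_rV d (T : measurableType d) (f : T -> 'rV[R]_n) :
  (forall i, measurable_fun [set: T] (fun t => f t 0 i)) ->
  measurable_fun [set: T] f.
Proof.
move=> mf; suff : g_sigma_preimage (fun i t => f t 0 i) `<=` measurable.
  rewrite (_ : (fun i t => _) = fun i => rV_coord i \o f)// => +.
  rewrite g_sigma_preimage_comp => prefS _ A mA.
  by apply: prefS; exists A.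
apply: smallest_sub; first exact: sigma_algebra_measurable.
case: n f mf => [|m] f mf; first by rewrite big_ord0.
rewrite -bigcup_mkord_ord; apply: bigcup_sub => i Ii.
by move=> A [B mB <-]; exact: mf.
Qed.

End measurable_rV.

Section lebesgue_rV.
Context {R : realType}.

Definition rV_cons n (p : measurableTypeR R * 'rV[R]_n) : 'rV[R]_n.+1 :=
  \row_j oapp (fun j' => p.2 0 j') p.1 (unlift ord0 j).

Definition rV_uncons n (x : 'rV[R]_n.+1) : measurableTypeR R * 'rV[R]_n :=
  (x 0 ord0, \row_j x 0 (lift ord0 j)).

Lemma rV_consK n : cancel (@rV_cons n) (@rV_uncons n).
Proof.
move=> [a x]; rewrite /rV_uncons /rV_cons; congr pair.
  by rewrite mxE unlift_none.
by apply/rowP => j; rewrite !mxE liftK.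
Qed.

Lemma rV_unconsK n : cancel (@rV_uncons n) (@rV_cons n).
Proof.
move=> x; apply/rowP => j; rewrite mxE.
by case: unliftP => [j' ->|->] //=; rewrite mxE.
Qed.

Lemma measurable_rV_cons n : measurable_fun setT (@rV_cons n).
Proof.
apply: measurable_fun_rV => i.
rewrite (_ : (fun _ => _) = fun p : measurableTypeR R * 'rV[R]_n =>
  oapp (fun j' => p.2 0 j') p.1 (unlift ord0 i)); last first.
  by apply/funext => p; rewrite mxE.
case: (unlift ord0 i) => [j|] /=; last exact: measurable_fst.
exact: (measurableT_comp (measurable_coord j) measurable_snd).
Qed.

Lemma measurable_rV_uncons n : measurable_fun setT (@rV_uncons n).
Proof.
apply/measurable_fun_pairP; split; first exact: measurable_coord.
apply: measurable_fun_rV => i /=.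
rewrite (_ : (fun _ => _) = fun x : 'rV[R]_n.+1 => x 0 (lift ord0 i)).
  exact: measurable_coord.
by apply/funext => p; rewrite mxE.
Qed.

Section step.
Variables (n : nat) (m : {sigma_finite_measure set 'rV[R]_n -> \bar R}).

Definition lebesgue_rV_step : set 'rV[R]_n.+1 -> \bar R :=
  pushforward (@lebesgue_measure R \x m)%E (@rV_cons n).

Let step_pre A : measurable A -> measurable (@rV_cons n @^-1` A).
Proof.
by move=> mA; rewrite -[X in measurable X]setTI; exact: measurable_rV_cons.
Qed.

Let step0 : lebesgue_rV_step set0 = 0%E.
Proof. by rewrite /lebesgue_rV_step /pushforward preimage_set0 measure0. Qed.

Let step_ge0 A : (0 <= lebesgue_rV_step A)%E.
Proof. by rewrite /lebesgue_rV_step /pushforward measure_ge0. Qed.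

Let step_sigma_additive : semi_sigma_additive lebesgue_rV_step.
Proof.
move=> F mF tF mUF; rewrite /lebesgue_rV_step /pushforward preimage_bigcup.
apply: measure_semi_sigma_additive.
- by move=> k; exact: step_pre.
- apply/trivIsetP => /= i j _ _ ij; rewrite -preimage_setI.
  by move/trivIsetP : tF => /(_ _ _ _ _ ij) ->//; rewrite preimage_set0.
- by rewrite -preimage_bigcup; exact: step_pre.
Qed.

HB.instance Definition _ := isMeasure.Build _ _ _ lebesgue_rV_step
  step0 step_ge0 step_sigma_additive.

Let step_sigma_finite : sigma_finite setT lebesgue_rV_step.
Proof.
have /sigma_finiteP[F [TF ndF Foo]] := sigma_finiteT (@lebesgue_measure R).
have /sigma_finiteP[G [TG ndG Goo]] := sigma_finiteT m.
exists (fun k => @rV_uncons n @^-1` (F k `*` G k)).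
  rewrite -preimage_bigcup (_ : \bigcup_k _ = setT) ?preimage_setT//.
  rewrite -subTset => -[a x] _.
  have : [set: measurableTypeR R] a by [].
  rewrite TF => -[i _ Fia].
  have : [set: 'rV[R]_n] x by [].
  rewrite TG => -[j _ Gjx]; exists (maxn i j) => //; split => /=.
    by move: a Fia; exact/subsetPset/ndF/leq_maxl.
  by move: x Gjx; exact/subsetPset/ndG/leq_maxr.
move=> k; have [mF Fk] := Foo k; have [mG Gk] := Goo k; split.
  rewrite -[X in measurable X]setTI; apply: measurable_rV_uncons => //.
  exact: measurableX.
rewrite /lebesgue_rV_step /pushforward -comp_preimage.
rewrite (_ : _ \o _ = id); last by apply/funext => p; exact: rV_consK.
by rewrite preimage_id product_measure1E// lte_mul_pinfty// ge0_fin_numE.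
Qed.

HB.instance Definition _ := @Measure_isSigmaFinite.Build _ _ _
  lebesgue_rV_step step_sigma_finite.

End step.

(* n-dimensional Lebesgue measure, as the n-fold product of the
   one-dimensional one. *)
Fixpoint lebesgue_rV (n : nat) : {sigma_finite_measure set 'rV[R]_n -> \bar R} :=
  match n with
  | 0%N => @dirac _ 'rV[R]_0 0 R
  | n'.+1 => lebesgue_rV_step (lebesgue_rV n')
  end.

End lebesgue_rV.

Lemma measurable_rV_box (R : realType) n (A : 'I_n -> set R) :
  (forall i, measurable (A i)) ->
  measurable [set x : 'rV[R]_n | forall i, A i (x 0 i)].
Proof.
move=> mA; have -> : [set x : 'rV[R]_n | forall i, A i (x 0 i)] =
    \big[setI/setT]_(i < n) ((fun x : 'rV[R]_n => x 0 i) @^-1` A i).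
  apply/seteqP; split => x /=; rewrite -bigcap_seq.
    by move=> Ax i _; exact: Ax.
  by move=> Ax i; apply: Ax => /=; rewrite mem_index_enum.
apply: bigsetI_measurable => i _; rewrite -[X in measurable X]setTI.
exact: measurable_coord.
Qed.

Lemma lebesgue_rV_box (R : realType) n (A : 'I_n -> set R) :
  (forall i, measurable (A i)) ->
  lebesgue_rV n [set x : 'rV[R]_n | forall i, A i (x 0 i)] =
    (\prod_(i < n) lebesgue_measure (A i))%E.
Proof.
elim: n A => [|n IHn] A mA.
  by rewrite big_ord0 /= diracE mem_set// => -[].
rewrite big_ord_recl /= /lebesgue_rV_step /pushforward.
rewrite -(IHn (fun i => A (lift ord0 i)))//.
rewrite -product_measure1E//; first last.
- by apply: (@measurable_rV_box _ _ (fun i => A (lift ord0 i))) => i; exact: mA.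
- exact: mA.
congr (_ _); apply/seteqP; split => -[a x] /= Ax.
  split; first by have := Ax ord0; rewrite mxE unlift_none.
  by move=> i; have := Ax (lift ord0 i); rewrite mxE liftK.
move=> i; rewrite mxE; case: Ax => Aa Ax.
by case: unliftP => [j ->|->] //=; exact: Ax.
Qed.

(* The library norm `|x| on row vectors is the sup norm. *)
Definition enorm (R : realType) n (x : 'rV[R]_n) : R :=
  Num.sqrt (\sum_i x 0 i ^+ 2).

Lemma measurable_enorm (R : realType) n :
  measurable_fun setT (@enorm R n).
Proof.
apply: measurableT_comp; first by apply: continuous_measurable_fun; exact: sqrt_continuous.
apply: measurable_sum => i; apply: measurable_funX; exact: measurable_coord.
Qed.

Lemma ler_coord_enorm (R : realType) n (x : 'rV[R]_n) i : `|x 0 i| <= enorm x.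
Proof.
rewrite -sqrtr_sqr ler_wsqrtr// (bigD1 i)//= lerDl.
by apply: sumr_ge0 => j _; exact: sqr_ge0.
Qed.

(* Surface measure on the unit sphere, viewed as a measure on R^N concentrated
   on the sphere: the area of A is N times the volume of the cone spanned by A
   in the unit ball. *)
Section sphere_measure.
Context (R : realType) (N : nat).

Definition sphere_cone (A : set 'rV[R]_N) : set 'rV[R]_N :=
  [set x | [/\ x != 0, enorm x < 1 & A ((enorm x)^-1 *: x)]].

Definition sphere_measure (A : set 'rV[R]_N) : \bar R :=
  (N%:R%:E * lebesgue_rV N (sphere_cone A))%E.

Let measurable_dir : measurable_fun setT (fun x : 'rV[R]_N => (enorm x)^-1 *: x).
Proof.
apply: measurable_fun_rV => i.
rewrite (_ : (fun _ => _) = (fun x => (@enorm R N x)^-1) \* (fun x => x 0 i));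
  last by apply/funext => x; rewrite mxE.
apply: measurable_funM; last exact: measurable_coord.
rewrite (_ : (fun x => _) = (fun x => powR (enorm x) (-1))); last first.
  by apply/funext => x; rewrite powR_inv1// sqrtr_ge0.
apply: (measurableT_comp (f := (@powR R)^~ (-1))); first exact: measurable_powR.
exact: measurable_enorm.
Qed.

Let measurable_cone A : measurable A -> measurable (sphere_cone A).
Proof.
move=> mA.
have -> : sphere_cone A = (enorm (n:=N) @^-1` `]-oo, 1[) `&`
    ~` [set x | forall i, [set 0] (x 0 i)] `&`
    ((fun x => (enorm x)^-1 *: x) @^-1` A).
  apply/seteqP; split => x /=; rewrite in_itv/=.
    case=> x0 x1 Ax; split=> //; split=> // x00; move/negP: x0; apply.
    by apply/eqP/rowP => i; rewrite mxE; exact: x00.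
  move=> [[x1 x0] Ax]; split=> //; apply: contra_notN x0 => /eqP -> i.
  by rewrite mxE.
apply: measurableI; first apply: measurableI.
- by rewrite -[X in measurable X]setTI; exact: measurable_enorm.
- by apply: measurableC; exact: (measurable_rV_box (fun i => measurable_set1 0)).
- by rewrite -[X in measurable X]setTI; exact: measurable_dir.
Qed.

Let sphere_measure0 : sphere_measure set0 = 0%E.
Proof.
rewrite /sphere_measure (_ : sphere_cone set0 = set0) ?measure0 ?mule0//.
by apply/seteqP; split => x // [].
Qed.

Let sphere_measure_ge0 A : (0 <= sphere_measure A)%E.
Proof. by rewrite mule_ge0// lee_fin ler0n. Qed.

Let sphere_measure_sigma_additive : semi_sigma_additive sphere_measure.
Proof.
move=> F mF tF mUF; rewrite /sphere_measure.
under eq_fun => k do rewrite -ge0_sume_distrr//.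
apply: cvgeZl => //.
rewrite (_ : sphere_cone _ = \bigcup_k sphere_cone (F k)); last first.
  apply/seteqP; split => x /=; first by case=> ? ? [k _ ?]; exists k.
  by case=> k _ [? ? ?]; split => //; exists k.
apply: measure_semi_sigma_additive.
- by move=> k; exact: measurable_cone.
- apply/trivIsetP => i j _ _ ij; apply/seteqP; split => // x [[_ _ Fi] [_ _ Fj]].
  suff : (F i `&` F j) ((enorm x)^-1 *: x).
    by move/trivIsetP : tF => /(_ i j Logic.I Logic.I ij) ->.
  by split.
- by apply: bigcup_measurable => k _; exact: measurable_cone.
Qed.

HB.instance Definition _ := isMeasure.Build _ _ _ sphere_measure
  sphere_measure0 sphere_measure_ge0 sphere_measure_sigma_additive.

Let sphere_measure_fin : fin_num_fun sphere_measure.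
Proof.
move=> A mA; rewrite fin_numM// ge0_fin_numE//.
have m1 (i : 'I_N) : measurable [set` `]-1, (1:R)[] by exact: measurable_itv.
have mB := measurable_rV_box m1; have vB := lebesgue_rV_box m1.
apply: (@le_lt_trans _ _ (lebesgue_rV N
    [set x | forall i, [set` `]-1, 1[] (x 0 i)])).
  apply: le_measure; rewrite ?inE//; first exact: measurable_cone.
  move=> x [_ x1 _] i /=; rewrite in_itv/= -ltr_norml.
  exact: le_lt_trans (ler_coord_enorm _ _) x1.
rewrite [ltLHS]vB; apply: (@le_lt_trans _ _ (2 ^+ N)%:E); last exact: ltry.
rewrite (eq_bigr (fun=> 2%:E)); last first.
  by move=> i _; rewrite lebesgue_measure_itv/= lte_fin gtrN// -EFinB opprK.
by rewrite prodEFin big_const_ord iter_mulr_1.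
Qed.

HB.instance Definition _ := @Measure_isFinite.Build _ _ _ sphere_measure
  sphere_measure_fin.

End sphere_measure.

Section problem.
Context {R : realType} {N : nat}.

(* lebesgue_measure lives on measurableTypeR R, which is convertible to R. *)
Local Notation spacetime := (measurableTypeR R * 'rV[R]_N)%type.

Definition unit_ball : set 'rV[R]_N := [set x | enorm x < 1].

Definition unit_sphere : set 'rV[R]_N := [set x | enorm x = 1].

Definition Omega : set spacetime := `]0, +oo[%classic `*` ~` unit_ball.

Definition Gamma : set spacetime := `]0, +oo[%classic `*` unit_sphere.

Definition volume : set spacetime -> \bar R :=
  (@lebesgue_measure R \x lebesgue_rV N)%E.

Definition area : set spacetime -> \bar R :=
  (@lebesgue_measure R \x @sphere_measure R N)%E.

Definition dt (phi : spacetime -> R) (z : spacetime) : R :=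
  derive1 (fun t : R => phi (t, z.2)) z.1.

Definition dx (i : 'I_N) (phi : spacetime -> R) (z : spacetime) : R :=
  'D_(delta_mx 0 i) (fun x => phi (z.1, x)) z.2.

Definition laplacian (phi : spacetime -> R) (z : spacetime) : R :=
  \sum_i dx i (dx i phi) z.

Definition divergence (F : spacetime -> 'rV[R]_N) (z : spacetime) : R :=
  \sum_i dx i (fun w => F w 0 i) z.

(* Derivative along nu(x) = - x, the normal pointing out of the exterior
   domain. *)
Definition normal_derivative (phi : spacetime -> R) (z : spacetime) : R :=
  'D_(- z.2) (fun x => phi (z.1, x)) z.2.

Definition C12_open (U : set spacetime) (phi : spacetime -> R) : Prop :=
  [/\ {in U, continuous phi},
      (forall z, U z -> derivable (fun t : R => phi (t, z.2)) z.1 1) /\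
        {in U, continuous (dt phi)},
      forall i, (forall z, U z ->
          derivable (fun x => phi (z.1, x)) z.2 (delta_mx 0 i)) /\
        {in U, continuous (dx i phi)} &
      forall i j, (forall z, U z ->
          derivable (fun x => dx i phi (z.1, x)) z.2 (delta_mx 0 j)) /\
        {in U, continuous (dx j (dx i phi))} ].

(* D = Omega is not open: a C^{1,2} function on D is the restriction of one on
   an open neighbourhood of D, so that its derivatives make sense on Gamma.
   Test functions are total functions, used only through their germ along
   Omega. *)
Definition C12 (D : set spacetime) (phi : spacetime -> R) : Prop :=
  exists U, [/\ open U, D `<=` U & C12_open U phi].

Definition support_in (D : set spacetime) (phi : spacetime -> R) : set spacetime :=
  closure (D `&` [set z | phi z != 0]).

Definition compactly_supported (D : set spacetime) (phi : spacetime -> R) : Prop :=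
  compact (support_in D phi) /\ support_in D phi `<=` D.

Definition neumann_test (k : R) (phi : spacetime -> R) : Prop :=
  [/\ C12 Omega phi, forall z, Omega z -> 0 <= phi z,
      compactly_supported Omega phi &
      forall z, Gamma z -> normal_derivative phi z + k * phi z = 0].

Definition dirichlet_test (psi : spacetime -> R) : Prop :=
  [/\ C12 Omega psi, forall z, Omega z -> 0 <= psi z,
      compactly_supported Omega psi,
      forall z, Gamma z -> psi z = 0 &
      forall z, Gamma z -> normal_derivative psi z <= 0].

Definition Lp_loc (p : R) (D : set spacetime) (u : spacetime -> R) : Prop :=
  measurable_fun D u /\
  forall K, K `<=` D -> compact K ->
    (\int[volume]_(z in K) (`|u z| `^ p)%:E < +oo)%E.

(* -Delta phi + k div (phi x / |x|^2) *)
Definition adjoint_op (k : R) (phi : spacetime -> R) (z : spacetime) : R :=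
  - laplacian phi z +
  k * divergence (fun w => (phi w / enorm w.2 ^+ 2) *: w.2) z.

(* For u in L^p_loc, f integrable on the sphere and a test function phi, all
   the integrands below are integrable, so that the real-valued integrals are
   genuine ones. *)
Definition neumann_weak_solution (alpha sigma k p : R) (f : 'rV[R]_N -> R)
    (u : spacetime -> R) : Prop :=
  Lp_loc p Omega u /\
  forall phi, neumann_test k phi ->
    \int[volume]_(z in Omega)
       (z.1 `^ alpha * enorm z.2 `^ sigma * `|u z| `^ p * phi z)
    + \int[area]_(z in Gamma) (f z.2 * phi z)
    <= - (\int[volume]_(z in Omega) (u z * dt phi z))
       + \int[volume]_(z in Omega) (adjoint_op k phi z * u z).

Definition dirichlet_weak_solution (alpha sigma k p : R) (f : 'rV[R]_N -> R)
    (u : spacetime -> R) : Prop :=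
  Lp_loc p Omega u /\
  forall psi, dirichlet_test psi ->
    \int[volume]_(z in Omega)
       (z.1 `^ alpha * enorm z.2 `^ sigma * `|u z| `^ p * psi z)
    - \int[area]_(z in Gamma) (f z.2 * normal_derivative psi z)
    <= - (\int[volume]_(z in Omega) (u z * dt psi z))
       + \int[volume]_(z in Omega) (adjoint_op k psi z * u z).

End problem.

(* Main.v *)
Require Import Defs.
From HB Require Import structures.
From mathcomp Require Import all_boot all_order all_algebra.
From mathcomp Require Import all_classical all_reals all_analysis.
From mathcomp Require Import measurable_realfun ring lra.

Import Order.TTheory GRing.Theory Num.Theory.
Import numFieldNormedType.Exports.

(** The proof is the method of test functions, with a family of test functions
adapted to the adjoint operator L phi = - Delta phi + k div (phi x / |x|^2).

The radial solutions of L H = 0 are spanned by |x|^k and |x|^(2-N). The first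
one satisfies the Neumann-type condition on the unit sphere; the difference
H = |x|^k - |x|^(2-N) vanishes there, is positive outside because k > 2 - N, and
has a strictly negative derivative along the normal. With q = |x|^2, both cases
are H = q^(k/2) - b q^((2-N)/2), for b = 0 or b = 1 ([profile]).

At scale rho take phi = H X^m Y^m, where X and Y are the positive parts of
1 - ((t - 2 rho)/rho)^2 and 1 - ((q - 1)/rho)^2, so that phi lives at times of
order rho and radii up to order sqrt rho, which is the parabolic scaling. The
truncation Y is stationary at q = 1 and therefore does not disturb the boundary
conditions. As L H = 0, at least one derivative always falls on X or Y, hence
|d_t phi| + |L phi| <= (C / rho) (X Y)^(m-2) H ([derivatives_test_le]).

Inserting phi in the weak inequality, the boundary term is at least
c rho I_f with c > 0. The terms linear in u are absorbed by the term in |u|^p: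
by Young's inequality they leave the remainder
rho^(-p/(p-1)) (t^alpha |x|^sigma)^(-1/(p-1)) H on the support of phi
([young_cutoff], [integral_absorption]). Its integral is estimated by cutting
the support into the shells 4^i < q <= 4^(i+1), whose contributions grow at most
geometrically ([dyadic_integral_le]). For rho = 4^j this gives
I_f <= D (lam / Lam)^j, where Lam = 4^((p + alpha)/(p-1)) and lam is any number
exceeding 1 and at least 4^((k + N - sigma/(p-1))/2). As alpha >= -1, Lam exceeds
1, and the bound on p says exactly that it exceeds the other number as well
([subcritical]). So lam can be taken smaller than Lam, and j -> oo contradicts
I_f > 0 ([no_solution]). *)

Local Open Scope classical_set_scope.
Local Open Scope ring_scope.

Set Implicit Arguments.
Unset Strict Implicit.
Unset Printing Implicit Defensive.

(** * Powers of the positive part *)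

Section positive_power.
Context {R : realType}.
Implicit Types (x y : R) (m : nat).

(** A high power of a positive part serves as cutoff instead of a smooth bump:
it is C^2 from the exponent 3 on, and its derivatives are bounded by explicit
lower powers of the same quantity. *)
Definition ppow m y : R := Num.max 0 y ^+ m.

Lemma continuous_ppow m : continuous (ppow m).
Proof.
move=> y; apply: (@continuous_comp _ _ _ (fun h : R => Num.max 0 h) (fun z => z ^+ m)).
  by apply: (@continuous_max _ _ (cst 0) id); [exact: cvg_cst|exact: cvg_id].
exact: exprn_continuous.
Qed.

(** Only the origin needs an argument: there the difference quotient is itself a
positive power of the positive part, which tends to 0 as the exponent is at
least 2. *)
Lemma is_derive_ppow m y : is_derive y 1 (ppow m.+2) (m.+2%:R * ppow m.+1 y).
Proof.
have [y0|y0|y0] := ltgtP y 0.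
- rewrite {2}/ppow max_l ?ltW// expr0n /= mulr0.
  apply: (@near_eq_is_derive _ _ _ (cst 0)).
  near=> z; rewrite /ppow max_l ?expr0n//; apply/ltW; near: z; exact: lt_nbhsl.
- rewrite {2}/ppow max_r ?ltW//.
  have h : is_derive y 1 (fun z : R => z ^+ m.+2) (m.+2%:R * y ^+ m.+1).
    apply: DeriveDef; first exact: exprn_derivable.
    by rewrite -derive1E exp_derive1.
  apply: near_eq_is_derive h.
  near=> z; rewrite /ppow max_r//; apply/ltW; near: z; exact: lt_nbhsr.
rewrite y0 {2}/ppow maxxx expr0n/= mulr0.
suff h : (fun h : R => h^-1 *: (ppow m.+2 (h *: (1 : R) + 0) - ppow m.+2 0)) @ 0^' --> (0:R).
  by apply: DeriveDef; [apply/cvg_ex; exists 0|apply/cvg_lim].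
have hc : ppow m.+1 h @[h --> 0^'] --> (0:R).
  rewrite [X in _ --> X](_ : _ = ppow m.+1 0); last by rewrite /ppow maxxx expr0n.
  apply: (cvg_trans _ (@continuous_ppow m.+1 0)).
  by apply: cvg_app; exact: nbhs_dnbhs.
apply: cvg_trans hc; apply: near_eq_cvg; near=> h.
have h0 : h != 0 by near: h; exact: nbhs_dnbhs_neq.
rewrite /ppow maxxx expr0n /= subr0 [_ *: 1]mulr1 addr0.
by have [hlt|hge] := ltP h 0; rewrite ?expr0n ?scaler0// [in RHS]exprS scalerA mulVf// scale1r.
Unshelve. all: by end_near. Qed.

End positive_power.

(** * Directional derivatives of functions given pointwise *)

Section pointwise_derivatives.
Context {R : realType} {V : normedModType R}.
Implicit Types (f g : V -> R) (x v : V).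

Lemma is_deriveMf f g x v (df dg : R) : is_derive x v f df -> is_derive x v g dg ->
  is_derive x v (fun y => f y * g y) (df * g x + f x * dg).
Proof.
move=> hf hg; have h := is_deriveM hf hg.
by rewrite addrC [df * _]mulrC; exact: h.
Qed.

Lemma is_deriveMlf f x v (c df : R) : is_derive x v f df ->
  is_derive x v (fun y => c * f y) (c * df).
Proof.
move=> hf; have h := is_deriveMf (is_derive_cst c x v) hf.
by rewrite mul0r add0r in h.
Qed.

Lemma is_deriveDf f g x v (df dg : R) : is_derive x v f df -> is_derive x v g dg ->
  is_derive x v (fun y => f y + g y) (df + dg).
Proof. by move=> hf hg; exact: is_deriveD. Qed.

Lemma is_deriveBf f g x v (df dg : R) : is_derive x v f df -> is_derive x v g dg ->
  is_derive x v (fun y => f y - g y) (df - dg).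
Proof. by move=> hf hg; exact: is_deriveB. Qed.

(** On the line h |-> h v + x this is the chain rule in one variable, so [f] is
differentiated along [v] only. *)
Lemma is_derive_compf (G : R -> R) f x v (dG df : R) :
  is_derive (f x) 1 G dG -> is_derive x v f df ->
  is_derive x v (fun y => G (f y)) (dG * df).
Proof.
move=> hG hf.
have e : f x = f (0 *: v + x) by rewrite scale0r add0r.
have hf1 : is_derive (0:R) 1 (fun h : R => f (h *: v + x)) df.
  have [/derivable1P d1 _] := hf.
  apply: DeriveDef => //; have [_ <-] := hf.
  rewrite /derive; set g1 := fun h => h^-1 *: _; set g2 := fun h => h^-1 *: _.
  suff -> : g1 = g2 by [].
  by apply/funext => h; rewrite /g1 /g2 /= addr0 scale0r add0r [_%:A]mulr1.
have h : is_derive (0:R) 1 (G \o (fun h : R => f (h *: v + x))) (dG * df).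
  by apply: is_derive1_comp; rewrite -e.
have d1 : derivable (fun y => G (f y)) x v.
  by have [+ _] := h; move=> ?; apply/derivable1P.
apply: DeriveDef => //; have [_ <-] := h.
rewrite /derive; set g1 := fun h => h^-1 *: _; set g2 := fun h => h^-1 *: _.
suff -> : g1 = g2 by [].
by apply/funext => z; rewrite /g1 /g2 /= addr0 scale0r add0r [_%:A]mulr1.
Qed.

End pointwise_derivatives.

(** * Calculus in the squared radius *)

Section radial_calculus.
Context {R : realType} {N : nat}.
Local Notation spacetime := (measurableTypeR R * 'rV[R]_N)%type.
Implicit Types (x v : 'rV[R]_N) (z : spacetime) (i j : 'I_N).

(** The squared Euclidean norm is a polynomial, so that radial functions written
in this variable are differentiated without square roots. *)
Definition nsq x : R := \sum_i x 0 i ^+ 2.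

Lemma nsq_ge0 x : 0 <= nsq x.
Proof. by apply: sumr_ge0 => i _; exact: sqr_ge0. Qed.

Lemma enorm_nsq x : enorm x ^+ 2 = nsq x.
Proof. by rewrite sqr_sqrtr// nsq_ge0. Qed.

Lemma is_derive_coord x v i : is_derive x v (fun y : 'rV[R]_N => y 0 i) (v 0 i).
Proof.
have h : (fun h : R => h^-1 *: ((h *: v + x) 0 i - x 0 i)) @ 0^' --> v 0 i.
  apply: cvg_near_cst; near=> h.
  rewrite !mxE addrK /=.
  have h0 : h != 0 by near: h; exact: nbhs_dnbhs_neq.
  by rewrite scalerA mulVf// scale1r.
by apply: DeriveDef; [apply/cvg_ex; exists (v 0 i)|apply/cvg_lim].
Unshelve. all: by end_near. Qed.

Lemma is_derive_nsq x v : is_derive x v nsq (2 * \sum_i x 0 i * v 0 i).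
Proof.
have h := @is_derive_sum _ _ _ N (fun i (y : 'rV[R]_N) => y 0 i * y 0 i) x v
  (fun i => v 0 i * x 0 i + x 0 i * v 0 i)
  (fun i => is_deriveMf (is_derive_coord x v i) (is_derive_coord x v i)).
have e1 : nsq = \sum_(i < N) (fun y : 'rV[R]_N => y 0 i * y 0 i).
  by rewrite fct_sumE; apply/funext => y; apply: eq_bigr => i _; rewrite expr2.
rewrite e1 mulr_sumr; apply: is_derive_eq h _; apply: eq_bigr => i _.
by rewrite mulrC -mulr2n mulr_natl.
Qed.

Lemma is_derive_radial (G : R -> R) (g : R) x v : is_derive (nsq x) 1 G g ->
  is_derive x v (fun y => G (nsq y)) (g * (2 * \sum_i x 0 i * v 0 i)).
Proof. by move=> hG; exact: (is_derive_compf hG (is_derive_nsq x v)). Qed.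

Lemma sum_delta x i : \sum_j x 0 j * (delta_mx 0 i : 'rV[R]_N) 0 j = x 0 i.
Proof.
rewrite (bigD1 i)//= big1 ?addr0 => [|j ji]; rewrite !mxE eqxx /=.
  by rewrite eqxx mulr1.
by rewrite (negbTE ji) mulr0.
Qed.

Lemma continuous_nsq : continuous nsq.
Proof.
apply: (@continuous_big _ _ _ _ _ (@add_continuous R) _ _ (fun i (y : 'rV[R]_N) => y 0 i ^+ 2)) => i _ x.
apply: (@continuous_comp _ _ _ (fun y : 'rV[R]_N => y 0 i) (fun r : R => r ^+ 2)).
  exact: coord_continuous.
exact: exprn_continuous.
Qed.

Lemma continuous_space (g : 'rV[R]_N -> R) (D : set spacetime) :
  (forall z, D z -> {for z.2, continuous g}) ->
  {in D, continuous (fun z : spacetime => g z.2)}.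
Proof.
move=> cg z /set_mem /cg h.
by apply: (@continuous_comp _ _ _ (fun w : spacetime => w.2) g); [exact: cvg_snd|].
Qed.

Lemma continuous_time (g : R -> R) (D : set spacetime) : continuous g ->
  {in D, continuous (fun z : spacetime => g z.1)}.
Proof.
move=> cg z _.
by apply: (@continuous_comp _ _ _ (fun w : spacetime => w.1 : R) g); [exact: cvg_fst|exact: cg].
Qed.

End radial_calculus.

(** * Products of a function of time and a radial function *)

Section separated_function.
Context {R : realType} {N : nat}.
Local Notation spacetime := (measurableTypeR R * 'rV[R]_N)%type.
Implicit Types (x v : 'rV[R]_N) (z : spacetime) (i j : 'I_N).

Variables (A A1 G G1 G2 : R -> R).
Hypothesis dA : forall t : R, is_derive t 1 A (A1 t).
Hypothesis cA1 : continuous A1.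
Hypothesis dG : forall q : R, 0 < q -> is_derive q 1 G (G1 q).
Hypothesis dG1 : forall q : R, 0 < q -> is_derive q 1 G1 (G2 q).
Hypothesis cG2 : forall q : R, 0 < q -> {for q, continuous G2}.

Definition time_radial z : R := A z.1 * G (nsq z.2).

(** An open neighbourhood of the exterior domain on which a radial function is as
regular as its profile is on the positive half-line. *)
Definition off_axis : set spacetime := [set z | 0 < nsq z.2].

Lemma open_off_axis : open off_axis.
Proof.
have : continuous (fun z : spacetime => nsq z.2).
  move=> z; apply: (@continuous_comp _ _ _ (fun w : spacetime => w.2) nsq).
    exact: cvg_snd.
  exact: continuous_nsq.
by move/continuousP => /(_ _ (@open_gt R 0)).
Qed.

Lemma Omega_off_axis : @Omega R N `<=` off_axis.
Proof.
move=> z [_ /negP]; rewrite -leNgt => h.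
rewrite /off_axis /= -enorm_nsq exprn_gt0//; exact: lt_le_trans h.
Qed.

Lemma is_derive_dt_time_radial z :
  is_derive (z.1 : R) 1 (fun t => time_radial (t, z.2)) (A1 z.1 * G (nsq z.2)).
Proof.
have := is_deriveMlf (G (nsq z.2)) (dA z.1).
by under [X in is_derive _ _ X _ -> _]eq_fun do rewrite mulrC; rewrite mulrC.
Qed.

Lemma dt_time_radial z : dt time_radial z = A1 z.1 * G (nsq z.2).
Proof.
by rewrite /dt derive1E; have h := is_derive_dt_time_radial z; rewrite derive_val.
Qed.

Lemma is_derive_time_radial z v : off_axis z ->
  is_derive z.2 v (fun x => time_radial (z.1, x))
    (A z.1 * (G1 (nsq z.2) * (2 * \sum_i z.2 0 i * v 0 i))).
Proof.
move=> qz; rewrite /time_radial /=; apply: is_deriveMlf; apply: is_derive_radial.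
exact: dG.
Qed.

Lemma dx_time_radial i z : off_axis z ->
  dx i time_radial z = A z.1 * (G1 (nsq z.2) * (2 * z.2 0 i)).
Proof.
move=> qz; rewrite /dx -[in RHS](sum_delta z.2 i).
by have h := is_derive_time_radial (delta_mx 0 i) qz; rewrite derive_val.
Qed.

Lemma near_off_axis z : off_axis z -> \forall x \near z.2, off_axis (z.1, x).
Proof.
move=> qz; have : \forall y \near nsq z.2, 0 < y by exact: lt_nbhsr.
exact: continuous_nsq.
Qed.

(** The formula for the first derivative holds off the axis only; it is
differentiated after replacing the derivative by the formula near the point. *)
Lemma is_derive_dx_time_radial i j z : off_axis z ->
  is_derive z.2 (delta_mx 0 j) (fun x => dx i time_radial (z.1, x))
    (A z.1 * (G2 (nsq z.2) * (2 * z.2 0 j) * (2 * z.2 0 i)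
              + G1 (nsq z.2) * (2 * (i == j)%:R))).
Proof.
move=> qz; apply: (@near_eq_is_derive _ _ _
    (fun x => A z.1 * (G1 (nsq x) * (2 * x 0 i)))).
  by have := near_off_axis qz; apply: filterS => x qx; rewrite dx_time_radial.
apply: is_deriveMlf; apply: is_deriveMf.
  by have := is_derive_radial (delta_mx 0 j) (dG1 qz); rewrite sum_delta.
by have := is_deriveMlf 2 (is_derive_coord z.2 (delta_mx 0 j) i); rewrite mxE eqxx.
Qed.

Lemma dx2_time_radial i j z : off_axis z ->
  dx j (dx i time_radial) z =
    A z.1 * (G2 (nsq z.2) * (2 * z.2 0 j) * (2 * z.2 0 i)
              + G1 (nsq z.2) * (2 * (i == j)%:R)).
Proof.
by move=> qz; rewrite /dx; have h := is_derive_dx_time_radial i j qz; rewrite derive_val.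
Qed.

Lemma continuous_in_eq (D : set spacetime) (f g : spacetime -> R) : open D ->
  (forall z, D z -> f z = g z) -> {in D, continuous g} -> {in D, continuous f}.
Proof.
move=> oD fg cg z zD; have Dz := set_mem zD.
rewrite /prop_for /continuous_at (fg _ Dz); apply: (cvg_trans _ (cg z zD)).
apply: near_eq_cvg; have : nbhs z D by exact: open_nbhs_nbhs.
by apply: filterS => w Dw; rewrite fg.
Qed.

Lemma continuous_inM (D : set spacetime) (f g : spacetime -> R) :
  {in D, continuous f} -> {in D, continuous g} ->
  {in D, continuous (fun z => f z * g z)}.
Proof. by move=> cf cg z zD; apply: cvgM; [exact: cf|exact: cg]. Qed.

Lemma continuous_inD (D : set spacetime) (f g : spacetime -> R) :
  {in D, continuous f} -> {in D, continuous g} ->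
  {in D, continuous (fun z => f z + g z)}.
Proof. by move=> cf cg z zD; apply: cvgD; [exact: cf|exact: cg]. Qed.

Lemma continuous_derive (f : R -> R) (y d : R) : is_derive y 1 f d -> {for y, continuous f}.
Proof. by case=> h _; apply: differentiable_continuous; apply/derivable1_diffP. Qed.

Lemma C12_open_time_radial : C12_open off_axis time_radial.
Proof.
have cA : {in off_axis, continuous (fun z : spacetime => A z.1)}.
  by apply: continuous_time => t; exact: continuous_derive (dA t).
have crad (g : R -> R) : (forall q, 0 < q -> {for q, continuous g}) ->
    {in off_axis, continuous (fun z : spacetime => g (nsq z.2))}.
  move=> cg; apply: (continuous_space (g := fun x => g (nsq x))) => z qz.
  by apply: continuous_comp; [exact: continuous_nsq|exact: cg].
have cG : {in off_axis, continuous (fun z : spacetime => G (nsq z.2))}.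
  by apply: crad => q q0; exact: continuous_derive (dG q0).
have cG1 : {in off_axis, continuous (fun z : spacetime => G1 (nsq z.2))}.
  by apply: crad => q q0; exact: continuous_derive (dG1 q0).
have cc i : {in off_axis, continuous (fun z : spacetime => 2 * z.2 0 i)}.
  apply: continuous_inM; first by move=> z _; exact: cvg_cst.
  by apply: (continuous_space (g := fun x => x 0 i)) => z _; exact: coord_continuous.
have oU := open_off_axis.
split.
- exact: continuous_inM.
- split.
    by move=> z _; have [] := is_derive_dt_time_radial z.
  apply: (continuous_in_eq oU (fun z _ => dt_time_radial z)).
  by apply: continuous_inM => //; exact: continuous_time.
- move=> i; split; first by move=> z /(is_derive_time_radial (delta_mx 0 i)) [].
  apply: (continuous_in_eq oU (dx_time_radial i)).
  by apply: continuous_inM => //; exact: continuous_inM.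
- move=> i j; split; first by move=> z /(is_derive_dx_time_radial i j) [].
  apply: (continuous_in_eq oU (dx2_time_radial i j)).
  apply: continuous_inM => //; apply: continuous_inD.
    by do 2! apply: continuous_inM => //; exact: crad.
  by apply: continuous_inM => // z _; exact: cvg_cst.
Qed.

Lemma C12_time_radial : C12 Omega time_radial.
Proof.
exists off_axis; split; [exact: open_off_axis|exact: Omega_off_axis|].
exact: C12_open_time_radial.
Qed.

Lemma normal_derivative_time_radial z : off_axis z ->
  normal_derivative time_radial z = - (2 * nsq z.2 * (A z.1 * G1 (nsq z.2))).
Proof.
move=> qz; rewrite /normal_derivative.
have h := is_derive_time_radial (- z.2) qz; rewrite derive_val.
under eq_bigr do rewrite mxE mulrN -expr2.
by rewrite sumrN -/(nsq _); ring.
Qed.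

(** The sums over the coordinates collapse because the second derivatives of a
radial function depend on the direction through the squares of the coordinates,
which add up to [nsq]. *)
Lemma adjoint_op_time_radial (k : R) z : off_axis z ->
  adjoint_op k time_radial z = A z.1 * (k * (2 * G1 (nsq z.2)
      + (N%:R - 2) * (G (nsq z.2) / nsq z.2))
    - (4 * nsq z.2 * G2 (nsq z.2) + 2 * N%:R * G1 (nsq z.2))).
Proof.
move=> qz; have q0 : nsq z.2 != 0 by rewrite gt_eqF.
have -> : adjoint_op k time_radial z = - (\sum_i (A z.1 * (G2 (nsq z.2) * (2 * z.2 0 i)
   * (2 * z.2 0 i) + G1 (nsq z.2) * (2 * (i == i)%:R)))) +
   k * (\sum_i A z.1 * ((2 * (G1 (nsq z.2) / nsq z.2) - 2 * (G (nsq z.2) / nsq z.2 ^+ 2)) * z.2 0 i ^+ 2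
     + G (nsq z.2) / nsq z.2)).
  rewrite /adjoint_op /laplacian /divergence; congr (- _ + k * _).
    by apply: eq_bigr => i _; rewrite dx2_time_radial.
  apply: eq_bigr => i _; rewrite /dx.
  have hV : is_derive (nsq z.2) 1 (fun q => G q * q^-1)
      (G1 (nsq z.2) * (nsq z.2)^-1 + G (nsq z.2) * (- (nsq z.2) ^- 2)).
    apply: is_deriveMf; first exact: dG.
    apply: DeriveDef; first exact: (derivableV (f := @id R)).
    by rewrite (deriveV (f := @id R))// derive_id [_ *: _]mulr1.
  have h := is_deriveMlf (A z.1)
    (is_deriveMf (is_derive_radial (delta_mx 0 i) hV) (is_derive_coord z.2 (delta_mx 0 i) i)).
  rewrite sum_delta in h.
  have -> : (fun x => (time_radial (z.1, x) / enorm (z.1, x).2 ^+ 2 *: (z.1, x).2) 0 i) =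
    (fun x => A z.1 * (G (nsq x) * (nsq x)^-1 * x 0 i)).
    by apply/funext => x; rewrite mxE enorm_nsq /time_radial /=; ring.
  by rewrite derive_val mxE !eqxx /=; field.
have sumq (a b : R) : \sum_i (a * z.2 0 i ^+ 2 + b) = a * nsq z.2 + N%:R * b.
  by rewrite big_split/= -mulr_sumr sumr_const card_ord mulr_natl.
rewrite (eq_bigr (fun i => A z.1 * G2 (nsq z.2) * 4 * z.2 0 i ^+ 2 +
    A z.1 * G1 (nsq z.2) * 2)); last by move=> i _; rewrite eqxx /=; ring.
rewrite sumq -mulr_sumr sumq.
by field.
Qed.

End separated_function.

(** * A bump function at scale rho *)

Section bump_function.
Context {R : realType}.
Variables (c rho : R).
Hypothesis rho0 : 0 < rho.
Implicit Types (m : nat) (s : R).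

Definition hat m s : R := ppow m (1 - ((s - c) / rho) ^+ 2).

(** For [m >= 3], [hat1 m] and [hat2 m] are the first two derivatives of [hat m]. *)
Definition hat1 m s : R := - (2 * m%:R / rho ^+ 2) * ((s - c) * hat m.-1 s).

Definition hat2 m s : R :=
  - (2 * m%:R / rho ^+ 2) * (hat m.-1 s + (s - c) * hat1 m.-1 s).

Lemma is_derive_hat m s : is_derive s 1 (hat m.+2) (hat1 m.+2 s).
Proof.
have h1 : is_derive s 1 (fun s => (s - c) / rho) rho^-1.
  have h := is_deriveMf (is_deriveBf (is_derive_id s 1) (is_derive_cst c s 1))
    (is_derive_cst rho^-1 s 1).
  by rewrite subr0 mul1r mulr0 addr0 in h.
have h2 := is_deriveBf (is_derive_cst (1:R) s 1) (is_deriveMf h1 h1).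
have h3 := @is_derive_compf _ _ _ (fun y : R => 1 - ((y - c) / rho * ((y - c) / rho)))
  _ _ _ _ (is_derive_ppow m _) h2.
have -> : hat m.+2 = (fun y => ppow m.+2 (1 - ((y - c) / rho * ((y - c) / rho)))).
  by apply/funext => y; rewrite /hat expr2.
apply: is_derive_eq h3 _; rewrite /hat1 /= /hat -expr2.
by field; rewrite gt_eqF.
Qed.

Lemma is_derive_hat1 m s : is_derive s 1 (hat1 m.+3) (hat2 m.+3 s).
Proof.
apply: is_deriveMlf.
have h := is_deriveMf (is_deriveBf (is_derive_id s 1) (is_derive_cst c s 1))
  (is_derive_hat m s).
by rewrite subr0 mul1r in h.
Qed.

Lemma continuous_hat m : continuous (hat m).
Proof.
move=> s; apply: (@continuous_comp _ _ _ (fun s => 1 - ((s - c) / rho) ^+ 2) (@ppow R m)).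
  apply: cvgB; first exact: cvg_cst.
  apply: (@continuous_comp _ _ _ (fun s => (s - c) / rho) (fun r : R => r ^+ 2)).
    by apply: cvgMl; apply: cvgB; [exact: cvg_id|exact: cvg_cst].
  exact: exprn_continuous.
exact: continuous_ppow.
Qed.

Lemma continuous_hat1 m : continuous (hat1 m).
Proof.
move=> s; apply: cvgM; first exact: cvg_cst.
by apply: cvgM; [apply: cvgB; [exact: cvg_id|exact: cvg_cst]|exact: continuous_hat].
Qed.

Lemma continuous_hat2 m : continuous (hat2 m).
Proof.
move=> s; apply: cvgM; first exact: cvg_cst.
apply: cvgD; first exact: continuous_hat.
by apply: cvgM; [apply: cvgB; [exact: cvg_id|exact: cvg_cst]|exact: continuous_hat1].
Qed.

Lemma hat_ge0 m s : 0 <= hat m s.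
Proof. by rewrite /hat /ppow exprn_ge0// le_max lexx. Qed.

Lemma hat_base s : 0 <= hat 1 s <= 1.
Proof.
rewrite hat_ge0 /= /hat /ppow expr1 ge_max ler01 /=.
by rewrite gerBl sqr_ge0.
Qed.

Lemma hatE m s : hat m s = hat 1 s ^+ m.
Proof. by rewrite /hat /ppow expr1. Qed.

Lemma hat_le1 m s : hat m s <= 1.
Proof. by rewrite hatE; have /andP[? ?] := hat_base s; exact: exprn_ile1. Qed.

Lemma hat_leS m s : hat m.+1 s <= hat m s.
Proof.
rewrite (hatE m.+1) (hatE m) exprS; have /andP[h0 h1] := hat_base s.
by rewrite ler_piMl// exprn_ge0.
Qed.

Lemma hat_out m s : rho <= `|s - c| -> hat m.+1 s = 0.
Proof.
move=> h; rewrite /hat /ppow max_l ?expr0n// subr_le0 -real_normK ?num_real//.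
by rewrite exprn_ege1// normrM normfV (gtr0_norm rho0) ler_pdivlMr// mul1r.
Qed.

Lemma hat_in m s : `|s - c| <= rho / 2 -> (3 / 4) ^+ m <= hat m s.
Proof.
move=> h; have h1 : ((s - c) / rho) ^+ 2 <= 1 / 4.
  rewrite -real_normK ?num_real// normrM normfV (gtr0_norm rho0).
  have h2 : `|s - c| / rho <= 1 / 2 by rewrite ler_pdivrMr//; lra.
  have h3 : 0 <= `|s - c| / rho by rewrite divr_ge0// ltW.
  nra.
rewrite /hat /ppow lerXn2r ?nnegrE ?le_max ?lexx//; lra.
Qed.

(** A derivative costs a factor [1 / rho] and one power of the bump: the inner
factor [s - c] is at most [rho] where the bump does not vanish. *)
Lemma hat1_le m s : `|hat1 m.+2 s| <= 2 * m.+2%:R / rho * hat m.+1 s.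
Proof.
rewrite /hat1 /=; have [h|h] := leP rho `|s - c|.
  by rewrite hat_out// !mulr0 normr0.
rewrite normrM normrN (normrM (s - c)) (ger0_norm (hat_ge0 m.+1 s)) mulrA ler_wpM2r ?hat_ge0//.
rewrite (ger0_norm (x := 2 * m.+2%:R / rho ^+ 2)) ?divr_ge0 ?mulr_ge0 ?exprn_ge0 ?(ltW rho0)//.
have -> : 2 * m.+2%:R / rho = 2 * m.+2%:R / rho ^+ 2 * rho by field; rewrite gt_eqF.
by rewrite ler_wpM2l ?(ltW h)// divr_ge0 ?mulr_ge0 ?exprn_ge0 ?(ltW rho0)//.
Qed.

Lemma hat2_le m s : `|hat2 m.+3 s| <= 4 * m.+3%:R ^+ 2 / rho ^+ 2 * hat m.+1 s.
Proof.
rewrite /hat2 /=; have [h|h] := leP rho `|s - c|.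
  by rewrite /hat1 /= !hat_out// !mulr0 addr0 mulr0 normr0.
rewrite normrM normrN (ger0_norm (x := 2 * m.+3%:R / rho ^+ 2)) ?divr_ge0 ?mulr_ge0 ?exprn_ge0 ?(ltW rho0)//.
have h1 : `|hat m.+2 s + (s - c) * hat1 m.+2 s| <= (2 * m.+3%:R) * hat m.+1 s.
  apply: (le_trans (ler_normD _ _)); rewrite (normrM (s - c)) (ger0_norm (hat_ge0 m.+2 s)).
  have h2 := hat_leS m.+1 s.
  have h3 : `|s - c| * `|hat1 m.+2 s| <= rho * (2 * m.+2%:R / rho * hat m.+1 s).
    by apply: ler_pM => //; [exact: ltW|exact: hat1_le].
  have h4 : rho * (2 * m.+2%:R / rho * hat m.+1 s) = 2 * m.+2%:R * hat m.+1 s.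
    by field; rewrite gt_eqF.
  have h5 := hat_ge0 m.+1 s.
  rewrite h4 in h3; rewrite -natr1; nra.
have -> : 4 * m.+3%:R ^+ 2 / rho ^+ 2 * hat m.+1 s =
    2 * m.+3%:R / rho ^+ 2 * (2 * m.+3%:R * hat m.+1 s).
  by field; rewrite gt_eqF.
by rewrite ler_wpM2l// divr_ge0 ?mulr_ge0 ?exprn_ge0 ?(ltW rho0).
Qed.

End bump_function.

(** * Radial solutions of the adjoint equation *)

Section profile.
Context {R : realType}.
Variables (k d : R) (b : bool).
Hypothesis hk : 2 - d < k.
Implicit Types (q : R).

(** The exponent of |x|^(2-d), the Newtonian potential, in the variable |x|^2. *)
Definition newton_exp : R := (2 - d) / 2.

Local Notation e := newton_exp.

(** The amount [k / 2 - newton_exp] by which the exponents of the two solutions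
differ. *)
Definition growth_exp : R := (k + d - 2) / 2.

Local Notation mu := growth_exp.

(** For [b = false] this is |x|^k, which suits the Neumann-type condition. For
[b = true] it is |x|^k - |x|^(2-d), which vanishes on the unit sphere. Both
conditions are treated at once by keeping [b] as a parameter. *)
Definition profile q : R := q `^ (k / 2) - b%:R * q `^ e.

Definition profile1 q : R :=
  k / 2 * q `^ (k / 2 - 1) - b%:R * (e * q `^ (e - 1)).

Definition profile2 q : R :=
  k / 2 * ((k / 2 - 1) * q `^ (k / 2 - 1 - 1))
  - b%:R * (e * ((e - 1) * q `^ (e - 1 - 1))).

Lemma growth_exp_gt0 : 0 < mu.
Proof. by rewrite /growth_exp; move: hk => h; lra. Qed.

Lemma is_derive_profile q : 0 < q -> is_derive q 1 profile (profile1 q).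
Proof.
move=> q0; apply: is_deriveBf; first exact: is_derive1_powR.
by apply: is_deriveMlf; exact: is_derive1_powR.
Qed.

Lemma is_derive_profile1 q : 0 < q -> is_derive q 1 profile1 (profile2 q).
Proof.
move=> q0; apply: is_deriveBf.
  by apply: is_deriveMlf; exact: is_derive1_powR.
by do 2! apply: is_deriveMlf; exact: is_derive1_powR.
Qed.

Lemma continuous_powRq a q : 0 < q -> {for q, continuous (fun y : R => y `^ a)}.
Proof. by move=> q0; exact: continuous_derive (is_derive1_powR a q0). Qed.

Lemma continuous_profile2 q : 0 < q -> {for q, continuous profile2}.
Proof.
move=> q0; apply: cvgB.
  by do 2! (apply: cvgM; first exact: cvg_cst); exact: continuous_powRq.
by do 3! (apply: cvgM; first exact: cvg_cst); exact: continuous_powRq.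
Qed.

Lemma powRB1 a q : 0 < q -> q `^ (a - 1) = q `^ a / q.
Proof. by move=> q0; rewrite powRB ?(gt_eqF q0) ?implybT// powRr1// ltW. Qed.

Lemma profile_harmonic q : 0 < q ->
  k * (2 * profile1 q + (d - 2) * (profile q / q))
  - (4 * q * profile2 q + 2 * d * profile1 q) = 0.
Proof.
move=> q0; rewrite /profile1 /profile2 /profile !powRB1// /newton_exp.
by field; rewrite gt_eqF.
Qed.

Lemma profileE q : 0 < q -> profile q = q `^ e * (q `^ mu - b%:R).
Proof.
move=> q0; rewrite /profile mulrBr [_ * b%:R]mulrC -powRD ?(gt_eqF q0) ?implybT//.
by congr (_ `^ _ - _); rewrite /growth_exp /newton_exp; field.
Qed.

(** Bernoulli's inequality in the form 1 + mu ln q <= q^mu, with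
ln q >= 1 - 1/q. *)
Lemma powR_growth q : 1 <= q -> mu * (q - 1) <= q * (q `^ mu - 1).
Proof.
move=> q1; have q0 : 0 < q by exact: lt_le_trans q1.
have h1 : ln q^-1 <= q^-1 - 1.
  have := @le_ln1Dx R (q^-1 - 1); rewrite subrKC; apply.
  by rewrite ltrBrDr addNr invr_gt0.
rewrite lnV ?posrE// in h1.
have h2 : 1 + mu * ln q <= q `^ mu by rewrite /powR gt_eqF// expR_ge1Dx.
have h3 : mu * (1 - q^-1) <= mu * ln q.
  by rewrite ler_wpM2l ?(ltW growth_exp_gt0)//; lra.
have h4 : q * (mu * (1 - q^-1)) = mu * (q - 1) by field; rewrite gt_eqF.
by rewrite -h4 ler_wpM2l ?(ltW q0)//; lra.
Qed.

Lemma powR_mu_ge1 q : 1 <= q -> 1 <= q `^ mu.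
Proof.
by move=> q1; rewrite -(powRr0 q) ler_powR// ltW// growth_exp_gt0.
Qed.

Lemma profile_ge0 q : 1 <= q -> 0 <= profile q.
Proof.
move=> q1; have q0 : 0 < q by exact: lt_le_trans q1.
rewrite profileE// mulr_ge0 ?powR_ge0// subr_ge0 (le_trans _ (powR_mu_ge1 q1))//.
by case: (b); rewrite ?ler01.
Qed.

Lemma profile_le q : profile q <= q `^ (k / 2).
Proof. by rewrite /profile gerBl mulr_ge0 ?powR_ge0. Qed.

(** When a derivative falls on the profile and another one on the cutoff, the
former must be controlled by the profile itself, although the profile may vanish
at [q = 1] while its derivative does not. The derivative of the cutoff supplies
the compensating factor [q - 1]. *)
Lemma profile1_le rho q : 1 <= rho -> 1 <= q -> q <= 1 + rho ->
  q * `|profile1 q| * (q - 1) <= (`|e| + mu + 2) * rho * profile q.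
Proof.
move=> rho1 q1 q2; have q0 : 0 < q by exact: lt_le_trans q1.
have m0 := growth_exp_gt0; have H0 := profile_ge0 q1.
set E := q `^ e; set M := q `^ mu.
have E0 : 0 <= E by exact: powR_ge0.
have M1 : 1 <= M by exact: powR_mu_ge1.
have P : q `^ (k / 2) = E * M.
  rewrite -powRD ?(gt_eqF q0) ?implybT//; congr (_ `^ _).
  by rewrite /growth_exp /newton_exp; field.
have HE : profile q = E * (M - b%:R) by exact: profileE.
have EM0 : 0 <= mu * (E * M).
  by rewrite mulr_ge0 ?(ltW m0)// mulr_ge0// (le_trans ler01).
have h1 : q * profile1 q = e * profile q + mu * (E * M).
  rewrite /profile1 /profile !powRB1// P -/E /growth_exp /newton_exp.
  by field; rewrite gt_eqF.
have h2 : q * `|profile1 q| <= `|e| * profile q + mu * (E * M).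
  rewrite -[X in X * _](gtr0_norm q0) -normrM h1; apply: (le_trans (ler_normD _ _)).
  by rewrite (normrM e) (ger0_norm H0) (ger0_norm EM0).
(* The only place where [b = true] costs more: [M - 1] may be small, but not
   smaller than [q - 1] up to a factor of order [rho]. *)
have h3 : mu * ((q - 1) * M) <= (mu + 2) * rho * (M - b%:R).
  case: (b) => /=; last first.
    have t1 : mu * ((q - 1) * M) <= mu * (rho * M).
      by rewrite ler_wpM2l ?(ltW m0)// ler_wpM2r//; lra.
    have t2 : 0 <= rho * M by rewrite mulr_ge0//; lra.
    by lra.
  have := powR_growth q1; rewrite -/M => h.
  have h' : q * (M - 1) <= 2 * rho * (M - 1) by rewrite ler_wpM2r//; lra.
  have h'' : mu * ((q - 1) * (M - 1)) <= mu * (rho * (M - 1)).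
    by rewrite ler_wpM2l ?(ltW m0)// ler_wpM2r//; lra.
  lra.
have h4 : 0 <= `|e| * profile q by rewrite mulr_ge0.
have h5 : `|e| * profile q * (q - 1) <= `|e| * profile q * rho.
  by rewrite ler_wpM2l//; lra.
have h6 : E * (mu * ((q - 1) * M)) <= E * ((mu + 2) * rho * (M - b%:R)).
  by rewrite ler_wpM2l.
have h7 : q * `|profile1 q| * (q - 1) <= (`|e| * profile q + mu * (E * M)) * (q - 1).
  by rewrite ler_wpM2r//; lra.
rewrite HE in h5 h7 *; lra.
Qed.

End profile.

(** * The test functions *)

Section test_function.
Context {R : realType} {N : nat}.
Local Notation spacetime := (measurableTypeR R * 'rV[R]_N)%type.
Variables (k : R) (b : bool) (n : nat) (rho : R).
Hypothesis hk : 2 - N%:R < k.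
Hypothesis rho1 : 1 <= rho.
Implicit Types (z : spacetime) (q : R).

Let rho0 : 0 < rho. Proof. exact: lt_le_trans rho1. Qed.

Local Notation H := (profile k N%:R b).
Local Notation H1 := (profile1 k N%:R b).
Local Notation H2 := (profile2 k N%:R b).
Local Notation Y := (hat 1 rho n.+4).
Local Notation Y1 := (hat1 1 rho n.+4).
Local Notation Y2 := (hat2 1 rho n.+4).
Local Notation A := (hat (2 * rho) rho n.+4).
Local Notation A1 := (hat1 (2 * rho) rho n.+4).

Definition space_factor q : R := H q * Y q.

Definition space_factor1 q : R := H1 q * Y q + H q * Y1 q.

Definition space_factor2 q : R :=
  H2 q * Y q + H1 q * Y1 q + (H1 q * Y1 q + H q * Y2 q).

(** With the exponent [n.+4] the bumps are C^2, and two derivatives leave the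
power [n.+2], which is taken large in terms of [p]. The time factor
is centered at [2 * rho] to stay away from the time 0; the space factor is
centered at the unit sphere, where its derivative vanishes. *)
Definition test : spacetime -> R := time_radial A space_factor.

Definition cutoff z : R := hat (2 * rho) rho 1 z.1 * hat 1 rho 1 (nsq z.2).

Lemma is_derive_space_factor q : 0 < q ->
  is_derive q 1 space_factor (space_factor1 q).
Proof.
by move=> q0; apply: is_deriveMf; [exact: is_derive_profile|exact: is_derive_hat].
Qed.

Lemma is_derive_space_factor1 q : 0 < q ->
  is_derive q 1 space_factor1 (space_factor2 q).
Proof.
move=> q0; apply: is_deriveDf; apply: is_deriveMf;
  [exact: is_derive_profile1|exact: is_derive_hat|exact: is_derive_profile|
   exact: is_derive_hat1].
Qed.

Lemma continuous_space_factor2 q : 0 < q -> {for q, continuous space_factor2}.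
Proof.
move=> q0.
have c0 : {for q, continuous H} by exact: continuous_derive (is_derive_profile _ _ _ q0).
have c1 : {for q, continuous H1} by exact: continuous_derive (is_derive_profile1 _ _ _ q0).
have c2 : {for q, continuous H2} by exact: continuous_profile2.
have y0 : {for q, continuous Y} by exact: continuous_hat.
have y1 : {for q, continuous Y1} by exact: continuous_hat1.
have y2 : {for q, continuous Y2} by exact: continuous_hat2.
by apply: cvgD; apply: cvgD; apply: cvgM.
Qed.

Lemma C12_test : C12 Omega test.
Proof.
apply: (@C12_time_radial _ _ A A1 space_factor space_factor1 space_factor2).
- by move=> t; exact: is_derive_hat.
- exact: continuous_hat1.
- exact: is_derive_space_factor.
- exact: is_derive_space_factor1.
- exact: continuous_space_factor2.
Qed.

Lemma testE z : test z = cutoff z ^+ n.+4 * H (nsq z.2).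
Proof.
rewrite /test /time_radial /space_factor /cutoff exprMn -!hatE; ring.
Qed.

Lemma Omega_nsq z : Omega z -> 1 <= nsq z.2.
Proof.
by move=> [_ /negP]; rewrite -leNgt -enorm_nsq => h; rewrite exprn_ege1.
Qed.

Lemma Gamma_nsq z : Gamma z -> nsq z.2 = 1.
Proof. by move=> [_ /= h]; rewrite -enorm_nsq h expr1n. Qed.

Lemma Gamma_Omega z : Gamma z -> Omega z.
Proof.
by move=> [h1 h2]; split=> //=; rewrite /unit_ball /= (h2 : enorm _ = 1) ltxx.
Qed.

Lemma test_ge0 z : Omega z -> 0 <= test z.
Proof.
move=> /Omega_nsq h; rewrite /test /time_radial /space_factor mulr_ge0 ?hat_ge0//.
by rewrite mulr_ge0 ?hat_ge0//; exact: profile_ge0.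
Qed.

Lemma hat_center m c : hat c rho m c = 1.
Proof. by rewrite /hat subrr mul0r expr0n/= subr0 /ppow max_r// expr1n. Qed.

Lemma test_Gamma z : Gamma z -> test z = A z.1 * (1 - b%:R).
Proof.
by move=> /Gamma_nsq h; rewrite /test /time_radial h /space_factor hat_center
  /profile !powR1 !mulr1.
Qed.

Lemma normal_derivative_test z : Gamma z ->
  normal_derivative test z = - (A z.1 * (k - b%:R * (2 - N%:R))).
Proof.
move=> zG; have q1 := Gamma_nsq zG.
rewrite (normal_derivative_time_radial A is_derive_space_factor); last first.
  exact/Omega_off_axis/Gamma_Omega.
rewrite q1 /space_factor1 hat_center /hat1 subrr mul0r !mulr0.
by rewrite /profile1 !powR1 /newton_exp; field.
Qed.

Lemma dt_test z : dt test z = A1 z.1 * (H (nsq z.2) * Y (nsq z.2)).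
Proof.
exact: (dt_time_radial _ (is_derive_hat _ rho0 _)).
Qed.

Lemma adjoint_op_test z : Omega z -> let q := nsq z.2 in
  adjoint_op k test z = - (A z.1 * (8 * (q * H1 q * Y1 q) + 4 * (q * (H q * Y2 q))
     + 2 * (N%:R - k) * (H q * Y1 q))).
Proof.
move=> zO q; have qz := Omega_off_axis zO; have q0 : 0 < q by exact: qz.
rewrite (adjoint_op_time_radial A is_derive_space_factor is_derive_space_factor1)//.
have := profile_harmonic k N%:R b q0; rewrite -/q.
  rewrite /space_factor2 /space_factor1 /space_factor.
  move: (H q) (H1 q) (H2 q) (Y q) (Y1 q) (Y2 q) (A z.1) => h h1 h2 y y1 y2 a harm.
  transitivity (a * (y * (k * (2 * h1 + (N%:R - 2) * (h / q)) -
    (4 * q * h2 + 2 * N%:R * h1)) - (8 * (q * h1 * y1) + 4 * (q * (h * y2))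
     + 2 * (N%:R - k) * (h * y1)))); first by ring.
  by rewrite harm; ring.
Qed.

(** The sum of the constants of the four terms of [d_t phi] and [L phi] in which
the cutoff is differentiated. *)
Definition test_cst : R :=
  2 * n.+4%:R + 16 * n.+4%:R * (`|newton_exp N%:R| + growth_exp k N%:R + 2)
  + 32 * n.+4%:R ^+ 2 + 4 * n.+4%:R * `|N%:R - k|.

Lemma test_cst_gt0 : 0 < test_cst.
Proof.
have h := growth_exp_gt0 hk.
have h0 : (0 : R) < n.+4%:R by rewrite ltr0n.
have t1 : 0 <= 16 * n.+4%:R * (`|newton_exp N%:R : R| + growth_exp k N%:R + 2).
  by rewrite !mulr_ge0 ?addr_ge0// ltW.
have t2 : 0 <= 32 * n.+4%:R ^+ 2 :> R by rewrite mulr_ge0 ?sqr_ge0.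
have t3 : 0 <= 4 * n.+4%:R * `|N%:R - k| by rewrite !mulr_ge0// ltW.
rewrite /test_cst; lra.
Qed.

(** Since the profile solves the adjoint equation, every remaining term has a
derivative on the cutoff. A first derivative of [hat] in [q] gains only
[1 / rho], but it comes with [q] times the derivative of the profile, which
[profile1_le] controls, or with no factor [q]; a second derivative gains [1 / rho ^+ 2] and comes with [q <= 2 * rho]. *)
Lemma derivatives_test_le z : Omega z ->
  `|dt test z| + `|adjoint_op k test z| <=
  test_cst / rho * (cutoff z ^+ n.+2 * H (nsq z.2)).
Proof.
move=> zO; have q1 := Omega_nsq zO.
have H0 : 0 <= H (nsq z.2) by exact: profile_ge0.
rewrite dt_test adjoint_op_test// normrN.
set q := nsq z.2 in q1 H0 *.
(* Beyond the support of the space factor both sides vanish. *)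
have [qrho|qrho] := leP q (1 + rho); last first.
  have h : rho <= `|q - 1| by rewrite ger0_norm; lra.
  rewrite /hat2 /hat1 /= !(hat_out rho0 _ h) !(mulr0, addr0) normr0 addr0.
  rewrite mulr_ge0 ?divr_ge0 ?(ltW test_cst_gt0) ?(ltW rho0)//.
  by rewrite mulr_ge0// exprn_ge0// /cutoff mulr_ge0 ?hat_ge0.
have -> : cutoff z ^+ n.+2 = hat (2 * rho) rho n.+2 z.1 * hat 1 rho n.+2 q.
  by rewrite /cutoff exprMn -!hatE.
set a := hat (2 * rho) rho n.+2 z.1; set y := hat 1 rho n.+2 q.
have a0 : 0 <= a by exact: hat_ge0.
have y0 : 0 <= y by exact: hat_ge0.
have leA : A z.1 <= a by exact: le_trans (hat_leS _ _ n.+3 _) (hat_leS _ _ n.+2 _).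
have leY : Y q <= y by exact: le_trans (hat_leS _ _ n.+3 _) (hat_leS _ _ n.+2 _).
have A0 : 0 <= A z.1 by exact: hat_ge0.
have Y0 : 0 <= Y q by exact: hat_ge0.
have leA1 : `|A1 z.1| <= 2 * n.+4%:R / rho * a.
  apply: (le_trans (hat1_le _ rho0 _ _)); rewrite ler_wpM2l ?hat_leS//.
  by rewrite divr_ge0 ?(ltW rho0).
have leY1 : `|Y1 q| <= 2 * n.+4%:R / rho * y.
  apply: (le_trans (hat1_le _ rho0 _ _)); rewrite ler_wpM2l ?hat_leS//.
  by rewrite divr_ge0 ?(ltW rho0).
have leY1' : `|Y1 q| <= 2 * n.+4%:R / rho ^+ 2 * ((q - 1) * y).
  have K0 : 0 <= 2 * n.+4%:R / rho ^+ 2.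
    by rewrite divr_ge0 ?mulr_ge0 ?sqr_ge0 ?(ltW rho0) ?ler0n.
  have h : 0 <= (q - 1) * hat 1 rho n.+3 q by rewrite mulr_ge0 ?hat_ge0// subr_ge0.
  rewrite /hat1 mulNr normrN (ger0_norm (mulr_ge0 K0 h)) ler_wpM2l//.
  by rewrite ler_wpM2l ?subr_ge0//; exact: hat_leS.
have leY2 : `|Y2 q| <= 4 * n.+4%:R ^+ 2 / rho ^+ 2 * y.
  exact: hat2_le.
set M : R := n.+4%:R; rewrite -/M in leA1 leY1 leY1' leY2.
have M0 : 0 <= M by exact: ler0n.
have K0 : 0 <= 2 * M / rho ^+ 2.
  by rewrite divr_ge0 ?mulr_ge0 ?sqr_ge0 ?(ltW rho0).
have t1 : `|A1 z.1 * (H q * Y q)| <= 2 * M / rho * (a * y * H q).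
  rewrite normrM (ger0_norm (mulr_ge0 H0 Y0)).
  have -> : 2 * M / rho * (a * y * H q) = (2 * M / rho * a) * (H q * y) by ring.
  apply: ler_pM => //; first exact: mulr_ge0.
  exact: ler_wpM2l.
have t2 : `|q * H1 q * Y1 q| <=
    2 * M * (`|newton_exp N%:R| + growth_exp k N%:R + 2) / rho * (y * H q).
  have h := profile1_le b hk rho1 q1 qrho.
  have q0 : 0 <= q by exact: le_trans q1.
  rewrite (normrM (q * H1 q)) (normrM q) (ger0_norm q0).
  apply: (@le_trans _ _ (2 * M / rho ^+ 2 * (q * `|H1 q| * (q - 1)) * y)).
    have -> : 2 * M / rho ^+ 2 * (q * `|H1 q| * (q - 1)) * y =
      q * `|H1 q| * (2 * M / rho ^+ 2 * ((q - 1) * y)) by ring.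
    by rewrite ler_wpM2l// mulr_ge0.
  have -> : 2 * M * (`|newton_exp N%:R| + growth_exp k N%:R + 2) / rho * (y * H q)
    = 2 * M / rho ^+ 2 * ((`|newton_exp N%:R| + growth_exp k N%:R + 2) * rho * H q) * y.
    by field; rewrite gt_eqF.
  by rewrite ler_wpM2r// ler_wpM2l.
have t3 : `|q * (H q * Y2 q)| <= 8 * M ^+ 2 / rho * (y * H q).
  have q0 : 0 <= q by exact: le_trans q1.
  rewrite (normrM q) (normrM (H q)) (ger0_norm q0) (ger0_norm H0).
  have -> : 8 * M ^+ 2 / rho * (y * H q) =
     (2 * rho) * (H q * (4 * M ^+ 2 / rho ^+ 2 * y)) by field; rewrite gt_eqF.
  apply: ler_pM => //; [exact: mulr_ge0| |exact: ler_wpM2l].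
  by rewrite (le_trans qrho)// mulr_natl mulr2n lerD2r.
have t4 : `|H q * Y1 q| <= 2 * M / rho * (y * H q).
  rewrite (normrM (H q)) (ger0_norm H0).
  have -> : 2 * M / rho * (y * H q) = H q * (2 * M / rho * y) by ring.
  by rewrite ler_wpM2l.
have t5 : `|8 * (q * H1 q * Y1 q) + 4 * (q * (H q * Y2 q))
     + 2 * (N%:R - k) * (H q * Y1 q)| <= (test_cst - 2 * M) / rho * (y * H q).
  apply: (le_trans (ler_normD _ _)); apply: (le_trans (lerD (ler_normD _ _) (lexx _))).
  rewrite (normrM 8) (normrM 4) (normrM (2 * _)) (normrM 2) !normr_nat.
  have h : `|N%:R - k| * `|H q * Y1 q| <= `|N%:R - k| * (2 * M / rho * (y * H q)).
    by rewrite ler_wpM2l.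
  have -> : (test_cst - 2 * M) / rho * (y * H q) =
     8 * (2 * M * (`|newton_exp N%:R| + growth_exp k N%:R + 2) / rho * (y * H q))
     + 4 * (8 * M ^+ 2 / rho * (y * H q))
     + 2 * (`|N%:R - k| * (2 * M / rho * (y * H q))).
    by rewrite /test_cst -/M; ring.
  by rewrite -(mulrA 2 `|_|); apply: lerD; [apply: lerD|]; rewrite ler_wpM2l.
have t6 : `|A z.1 * (8 * (q * H1 q * Y1 q) + 4 * (q * (H q * Y2 q))
     + 2 * (N%:R - k) * (H q * Y1 q))| <= a * ((test_cst - 2 * M) / rho * (y * H q)).
  by rewrite normrM (ger0_norm A0); apply: ler_pM.
apply: (le_trans (lerD t1 t6)); rewrite le_eqVlt; apply/orP; left; apply/eqP.
by ring.
Qed.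

End test_function.

(** * Absorbing the terms that are linear in the solution *)

Section absorption.

(** Young's inequality, obtained by comparing [v] with the value at which
[v * beta * Z ^+ m.+1] and [w * Z ^+ m.+3 * v `^ p] balance. Below it, the left
side is at most the remainder, in which a nonnegative power of [Z] is left over
by the lower bound on [m]; above it, the term in [v `^ p] dominates. *)
Lemma young_cutoff {R : realType} (p w beta Z h v : R) (m : nat) : 1 < p ->
  0 < w -> 0 < beta -> 0 <= Z <= 1 -> 0 <= h -> 0 <= v ->
  2 / (p - 1) <= m.+1%:R ->
  v * (beta * (Z ^+ m.+1 * h)) <=
  w * (Z ^+ m.+3 * h) * v `^ p
    + beta `^ (1 + (p - 1)^-1) * w `^ (- (p - 1)^-1) * h.
Proof.
move=> p1 w0 b0 /andP[Z0 Z1] h0 v0 hm.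
have pm : 0 < p - 1 by rewrite subr_gt0.
set r := (p - 1)^-1.
have r0 : 0 < r by rewrite invr_gt0.
have rest0 : 0 <= beta `^ (1 + r) * w `^ (- r) * h by rewrite !mulr_ge0 ?powR_ge0.
have Zh j : 0 <= Z ^+ j * h by rewrite mulr_ge0// exprn_ge0.
have main0 : 0 <= w * (Z ^+ m.+3 * h) * v `^ p.
  by rewrite mulr_ge0 ?powR_ge0// mulr_ge0 ?(ltW w0).
move: Z0; rewrite le_eqVlt => /predU1P[Z00|Z0].
  have -> : v * (beta * (Z ^+ m.+1 * h)) = 0 by rewrite -Z00 exprS !mul0r !mulr0.
  exact: addr_ge0.
set theta := beta / (w * Z ^+ 2).
have t0 : 0 < theta by rewrite divr_gt0// mulr_gt0// exprn_gt0.
have [vt|vt] := leP v (theta `^ r).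
  apply: (@le_trans _ _ (beta `^ (1 + r) * w `^ (- r) * h)); last by rewrite lerDr.
  apply: (@le_trans _ _ (theta `^ r * (beta * (Z ^+ m.+1 * h)))).
    by rewrite ler_wpM2r// mulr_ge0 ?(ltW b0).
  have -> : theta `^ r = beta `^ r * w `^ (- r) * Z `^ (- (2 * r)).
    rewrite /theta powRM ?(ltW b0)//; last by rewrite invr_ge0 mulr_ge0 ?exprn_ge0 ?ltW.
    rewrite -powR_inv1; last by rewrite mulr_ge0 ?exprn_ge0 ?ltW.
    rewrite -powRrM mulN1r powRM ?exprn_ge0 ?(ltW w0) ?(ltW Z0)//.
    by rewrite -(powR_mulrn 2 (ltW Z0)) -powRrM mulrN mulrA.
  rewrite powRD ?(gt_eqF b0) ?implybT// powRr1 ?(ltW b0)//.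
  have hZ : Z `^ (- (2 * r)) * Z ^+ m.+1 <= 1.
    rewrite -powR_mulrn ?(ltW Z0)// -powRD ?(gt_eqF Z0) ?implybT//.
    rewrite -[leRHS](powRr0 Z) ger_powR ?Z0//.
    by rewrite addrC subr_ge0.
  have -> : beta `^ r * w `^ (- r) * Z `^ (- (2 * r)) * (beta * (Z ^+ m.+1 * h))
     = beta * beta `^ r * w `^ (- r) * h * (Z `^ (- (2 * r)) * Z ^+ m.+1) by ring.
  by rewrite ler_piMr// !mulr_ge0 ?powR_ge0 ?(ltW b0).
apply: (@le_trans _ _ (w * (Z ^+ m.+3 * h) * v `^ p)); last by rewrite lerDl.
have v1 : 0 < v by apply: le_lt_trans vt; exact: powR_ge0.
have hv : theta <= v `^ (p - 1).
  have := @ge0_ler_powR R (p - 1) (ltW pm) (theta `^ r) v (powR_ge0 _ _) v0 (ltW vt).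
  by rewrite -powRrM mulVf ?gt_eqF// powRr1// ltW.
rewrite -(mulr_powRB1 v0 (lt_trans ltr01 p1)).
have -> : v * (beta * (Z ^+ m.+1 * h)) = w * (Z ^+ m.+3 * h) * (v * theta).
  by rewrite /theta !exprS; field; rewrite !gt_eqF.
by rewrite ler_wpM2l ?ler_wpM2l// mulr_ge0 ?(ltW w0).
Qed.

Context d (T : measurableType d) (R : realType) (mu : {measure set T -> \bar R}).
Variables (D K : set T) (u : T -> R) (p : R).
Hypothesis p1 : 1 < p.
Hypothesis mD : measurable D.
Hypothesis mK : measurable K.
Hypothesis KD : K `<=` D.
Hypothesis Kfin : (mu K < +oo)%E.
Hypothesis meas_u : measurable_fun D u.
Hypothesis up : (\int[mu]_(x in K) (`|u x| `^ p)%:E < +oo)%E.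

Lemma measurable_norm_powR : measurable_fun D (fun x => `|u x| `^ p).
Proof.
apply: (measurableT_comp (f := (@powR R)^~ p)); first exact: measurable_powR.
exact: measurableT_comp.
Qed.

(** Functions that vanish off [K] and are of order at most [p] in [u] there. *)
Lemma integrable_dominated (M : R) (g : T -> R) : measurable_fun D g ->
  (forall x, D x -> ~ K x -> g x = 0) ->
  (forall x, K x -> `|g x| <= M * (1 + `|u x| `^ p)) ->
  mu.-integrable D (EFin \o g).
Proof.
move=> mg g0 gM; pose B := (fun x => (M * (1 + `|u x| `^ p))%:E).
have iB : mu.-integrable K B.
  apply: (@eq_integrable _ _ _ mu K mK
    (fun x => M%:E * ((EFin \o cst 1%R) x + (EFin \o (fun y => (`|u y| `^ p)%R)) x))%E) => //.
  apply: integrableZl => //; apply: integrableD => //.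
    by apply: measurable_bounded_integrable => //; exact: bounded_cst.
  apply/integrableP; split.
    apply/measurable_EFinP; apply: measurable_funS measurable_norm_powR => //.
  by under eq_integral do rewrite gee0_abs ?lee_fin ?powR_ge0//.
apply: (@le_integrable _ _ _ mu D mD _ (B \_ K)).
- exact/measurable_EFinP.
- move=> x Dx; rewrite /= patchE; case: ifPn => [/set_mem Kx|/negP Kx].
    rewrite /B lee_fin; apply: (le_trans (gM _ Kx)); exact: ler_norm.
  by rewrite g0// ?normr0// => Kx'; apply: Kx; exact: mem_set.
- by apply/integrable_restrict => //; rewrite setIidr.
Qed.

(** The pointwise inequality is integrated. The work lies in the integrability of
each term, without which the integrals could not be added: it follows from
[`|u| <= 1 + `|u| `^ p] on [K], which has finite measure. *)
Lemma integral_absorption (a W g1 g2 : T -> R) (M : R) :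
  measurable_fun D a -> measurable_fun D W -> measurable_fun D g1 -> measurable_fun D g2 ->
  (forall x, D x -> ~ K x -> [/\ a x = 0, W x = 0, g1 x = 0 & g2 x = 0]) ->
  (forall x, K x -> [/\ `|a x| <= M, `|W x| <= M, `|g1 x| <= M & `|g2 x| <= M]) ->
  (forall x, D x -> `|u x| * (`|g1 x| + `|g2 x|) <= a x * `|u x| `^ p + W x) ->
  - (\int[mu]_(x in D) (u x * g1 x)) + \int[mu]_(x in D) (g2 x * u x) <=
  \int[mu]_(x in D) (a x * `|u x| `^ p) + \int[mu]_(x in D) W x.
Proof.
move=> ma mW mg1 mg2 off bnd ptw.
have pow0 x : 0 <= `|u x| `^ p by exact: powR_ge0.
have M0 x : K x -> 0 <= M by move=> /bnd[h _ _ _]; exact: le_trans h.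
have ule x : `|u x| <= 1 + `|u x| `^ p.
  have [h|h] := leP `|u x| 1; first by rewrite ler_wpDr.
  by rewrite ler_wpDl// le1r_powR ?ltW.
have i1 : mu.-integrable D (EFin \o (fun x => u x * g1 x)).
  apply: (@integrable_dominated M); first exact: measurable_funM.
    by move=> x Dx Kx; have [_ _ -> _] := off x Dx Kx; rewrite mulr0.
  move=> x Kx; rewrite normrM mulrC; have [_ _ h _] := bnd x Kx.
  exact: ler_pM.
have i2 : mu.-integrable D (EFin \o (fun x => g2 x * u x)).
  apply: (@integrable_dominated M); first exact: measurable_funM.
    by move=> x Dx Kx; have [_ _ _ ->] := off x Dx Kx; rewrite mul0r.
  move=> x Kx; rewrite normrM; have [_ _ _ h] := bnd x Kx.
  exact: ler_pM.
have i3 : mu.-integrable D (EFin \o (fun x => a x * `|u x| `^ p)).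
  apply: (@integrable_dominated M).
  - by apply: measurable_funM => //; exact: measurable_norm_powR.
  - by move=> x Dx Kx; have [-> _ _ _] := off x Dx Kx; rewrite mul0r.
  - move=> x Kx; rewrite normrM (ger0_norm (pow0 x)); have [h _ _ _] := bnd x Kx.
    by apply: ler_pM => //; rewrite lerDr.
have i4 : mu.-integrable D (EFin \o W).
  apply: (@integrable_dominated M) => //.
  - by move=> x Dx Kx; have [_ -> _ _] := off x Dx Kx.
  - move=> x Kx; have [_ h _ _] := bnd x Kx; apply: (le_trans h).
    by rewrite ler_peMr ?(M0 _ Kx)// lerDl.
rewrite addrC -RintegralB// -RintegralD//; apply: le_Rintegral => //.
- exact: (integrableB mD i2 i1).
- exact: (integrableD mD i3 i4).
move=> x Dx; apply: le_trans (ptw x Dx).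
apply: (le_trans (ler_norm _)); apply: (le_trans (ler_normB _ _)).
by rewrite !normrM mulrDr addrC [`|g2 x| * _]mulrC.
Qed.

End absorption.

(** * Integrals of products over product domains *)

Section product_integral.
Context d1 d2 (T1 : measurableType d1) (T2 : measurableType d2) (R : realType).
Variables (m1 : {sigma_finite_measure set T1 -> \bar R})
  (m2 : {sigma_finite_measure set T2 -> \bar R}).

Lemma Rintegral_prod (D1 : set T1) (D2 : set T2) (g : T1 -> R) (h : T2 -> R) :
  measurable D1 -> measurable D2 ->
  m1.-integrable D1 (EFin \o g) -> m2.-integrable D2 (EFin \o h) ->
  \int[(m1 \x m2)%E]_(z in D1 `*` D2) (g z.1 * h z.2) =
  \int[m1]_(x in D1) g x * \int[m2]_(y in D2) h y.
Proof.
move=> mD1 mD2 ig ih.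
rewrite Rintegral_mkcond [in RHS](Rintegral_mkcond _ D1) [in RHS](Rintegral_mkcond _ D2).
have {}ig : m1.-integrable setT (EFin \o (g \_ D1)).
  by have /integrable_mkcond := ig; rewrite restrict_EFin; apply.
have {}ih : m2.-integrable setT (EFin \o (h \_ D2)).
  by have /integrable_mkcond := ih; rewrite restrict_EFin; apply.
set G := g \_ D1 in ig *; set H := h \_ D2 in ih *.
have -> : (fun z : T1 * T2 => g z.1 * h z.2) \_ (D1 `*` D2) = (fun z => G z.1 * H z.2).
  apply/funext => -[x y]; rewrite /G /H !patchE in_setX /=.
  by case: (x \in D1); case: (y \in D2); rewrite /= ?mulr0 ?mul0r.
have mG : measurable_fun setT G by apply/measurable_EFinP; exact: (measurable_int m1 ig).
have mH : measurable_fun setT H by apply/measurable_EFinP; exact: (measurable_int m2 ih).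
have mGH : measurable_fun setT (EFin \o (fun z : T1 * T2 => G z.1 * H z.2)).
  apply/measurable_EFinP; apply: measurable_funM.
    exact: (measurableT_comp mG measurable_fst).
  exact: (measurableT_comp mH measurable_snd).
have iH0 : (\int[m2]_y `|(H y)%:E| \is a fin_num)%E.
  by rewrite ge0_fin_numE ?integral_ge0//; case/integrableP : ih.
have inner x : (\int[m2]_y `|(G x * H y)%:E| = `|(G x)%:E| * \int[m2]_y `|(H y)%:E|)%E.
  under eq_integral do rewrite EFinM abseM.
  by rewrite ge0_integralZl// ; apply/measurable_EFinP; exact: measurableT_comp.
have iGH : (m1 \x m2)%E.-integrable setT (EFin \o (fun z : T1 * T2 => G z.1 * H z.2)).
  apply/integrable12ltyP => //=.
  under eq_integral do rewrite inner.
  rewrite ge0_integralZr//; last by apply: integral_ge0.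
    case/integrableP : ih => _ hH; case/integrableP : ig => _ hG.
    by apply: lte_mul_pinfty => //; [exact: integral_ge0|rewrite ge0_fin_numE ?integral_ge0].
  by apply/measurable_EFinP; exact: measurableT_comp.
rewrite /Rintegral -(integral12_prod_meas1 iGH) /fubini_F /=.
have -> : (\int[m1]_x \int[m2]_y (G x * H y)%:E = \int[m1]_x ((G x)%:E * \int[m2]_y (H y)%:E))%E.
  apply: eq_integral => x _; under eq_integral do rewrite EFinM.
  by rewrite integralZl.
have fH : (\int[m2]_y (H y)%:E \is a fin_num)%E by exact: integrable_fin_num ih.
rewrite -(fineK fH) integralZr//= fineM//.
exact: integrable_fin_num ig.
Qed.

End product_integral.

(** * Powers of the radius over dyadic shells *)

Section layers.
Context {R : realType} {N : nat}.
Local Notation spacetime := (measurableTypeR R * 'rV[R]_N)%type.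
Local Notation vol := (@lebesgue_measure R \x lebesgue_rV N)%E.

Lemma measurable_nsq : measurable_fun setT (@nsq R N).
Proof.
by apply: measurable_sum => i; apply: measurable_funX; exact: measurable_coord.
Qed.

Lemma measurable_nsq_itv (i : interval R) : measurable (@nsq R N @^-1` [set` i]).
Proof. by rewrite -[X in measurable X]setTI; exact: measurable_nsq. Qed.

(** The ball of radius [c] lies in the cube of side [2 * c]. *)
Lemma ball_volume_le (c : R) : 0 <= c ->
  (lebesgue_rV N (@nsq R N @^-1` [set` `]-oo, (c ^+ 2)%R]]) <= ((2 * c) ^+ N)%:E)%E.
Proof.
move=> c0; have mi (i : 'I_N) : measurable [set` `[- c, c]] by exact: measurable_itv.
have vB := lebesgue_rV_box mi.
apply: (@le_trans _ _ (lebesgue_rV N [set x | forall i, [set` `[- c, c]] (x 0 i)])).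
  apply: le_measure; rewrite ?inE; first exact: measurable_nsq_itv.
    exact: (measurable_rV_box mi).
  move=> x; rewrite /= in_itv/= => h i; rewrite /= in_itv/= -ler_norml.
  rewrite -(ler_pXn2r (n := 2))// ?nnegrE// real_normK ?num_real//.
  apply: le_trans h; rewrite /nsq (bigD1 i)//= lerDl.
  by apply: sumr_ge0 => j _; exact: sqr_ge0.
rewrite [leLHS]vB (eq_bigr (fun=> (2 * c)%:E)); last first.
  move=> i _; rewrite lebesgue_measure_itv/= lte_fin.
  case: ltP => h; first by rewrite -EFinB opprK mulr_natl mulr2n.
  have -> : c = 0 by lra.
  by rewrite mulr0.
by rewrite prodEFin big_const_ord iter_mulr_1.
Qed.

Definition shell (t : set R) (i : interval R) : set spacetime :=
  t `*` (@nsq R N @^-1` [set` i]).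

Lemma measurable_shell (t : set (measurableTypeR R)) i : measurable t -> measurable (shell t i).
Proof. by move=> mt; apply: measurableX => //; exact: measurable_nsq_itv. Qed.

Lemma shell_volume_le (t : set (measurableTypeR R)) (i : interval R) (L c : R) :
  measurable t -> lebesgue_measure t = L%:E -> 0 <= c ->
  [set` i] `<=` `]-oo, (c ^+ 2)] ->
  (vol (shell t i) <= (L * (2 * c) ^+ N)%:E)%E.
Proof.
move=> mt tL c0 ic; rewrite [leLHS](_ : _ = L%:E * lebesgue_rV N (@nsq R N @^-1` [set` i]))%E.
  have L0 : (0 <= L%:E)%E by rewrite -tL measure_ge0.
  rewrite EFinM; apply: lee_wpmul2l => //.
  apply: (le_trans _ (ball_volume_le c0)); apply: le_measure; rewrite ?inE.
  - exact: measurable_nsq_itv.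
  - exact: measurable_nsq_itv.
  - by move=> x /ic.
rewrite -tL; apply: product_measure1E => //; exact: measurable_nsq_itv.
Qed.

Lemma shell_integral_le (t : set (measurableTypeR R)) (i : interval R) (L c M a : R) :
  measurable t -> lebesgue_measure t = L%:E -> 0 <= c -> 0 <= M ->
  [set` i] `<=` `]-oo, (c ^+ 2)] -> (forall q, [set` i] q -> q `^ a <= M) ->
  (\int[vol]_(z in shell t i) (nsq z.2 `^ a)%:E <= (M * (L * (2 * c) ^+ N))%:E)%E.
Proof.
move=> mt tL c0 M0 ic iM; have mS := measurable_shell i mt.
have mf : measurable_fun (shell t i) (fun z : spacetime => nsq z.2 `^ a).
  apply: measurable_funS (measurableT) _ _ => //.
  apply: (measurableT_comp (f := (@powR R)^~ a)); first exact: measurable_powR.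
  exact: (measurableT_comp measurable_nsq measurable_snd).
apply: (@le_trans _ _ (\int[vol]_(z in shell t i) (cst M%:E z))%E).
  apply: ge0_le_integral => //.
  - by move=> z _; rewrite lee_fin powR_ge0.
  - exact/measurable_EFinP.
  - by move=> z [_ /iM h]; rewrite lee_fin.
rewrite integral_cst// EFinM; apply: lee_wpmul2l; first by rewrite lee_fin.
exact: shell_volume_le.
Qed.

Lemma powR_expn (x a : R) (j : nat) : 0 <= x -> (x ^+ j) `^ a = (x `^ a) ^+ j.
Proof. by move=> x0; rewrite -powR_mulrn// powRAC powR_mulrn// powR_ge0. Qed.

Lemma powR_dyadic_le (a q : R) (j : nat) : 4 ^+ j <= q -> q <= 4 ^+ j.+1 ->
  q `^ a <= 4 `^ `|a| * (4 `^ a) ^+ j.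
Proof.
move=> h1 h2; have j0 : 0 < (4 : R) ^+ j by rewrite exprn_gt0.
set s := q / 4 ^+ j.
have -> : q = 4 ^+ j * s by rewrite /s mulrC divfK ?gt_eqF.
have s1 : 1 <= s by rewrite ler_pdivlMr// mul1r.
have s4 : s <= 4 by rewrite ler_pdivrMr// -exprS.
rewrite powRM ?(ltW j0)//; last exact: le_trans s1.
rewrite powR_expn// mulrC ler_wpM2r ?exprn_ge0 ?powR_ge0//.
apply: (@le_trans _ _ (s `^ `|a|)); first by rewrite ler_powR// ler_norm.
by apply: ge0_ler_powR; rewrite ?nnegrE//; exact: le_trans s1.
Qed.

(** On the shell 4^i < q <= 4^(i+1) the integrand is at most a constant times
4^(a i) and the volume at most a constant times 2^(N i), so the shells contribute
at most a geometric sum of ratio [lam]. Requiring [1 < lam] covers the case of a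
convergent or logarithmically divergent integral, and the constant is the one
that makes the induction on [j] close. *)
Lemma dyadic_integral_le (t : set (measurableTypeR R)) (L a lam : R) (j : nat) :
  measurable t -> lebesgue_measure t = L%:E -> 1 < lam ->
  4 `^ a * 2 ^+ N <= lam ->
  (\int[vol]_(z in shell t `[1%R, (4 ^+ j)%R]) (nsq z.2 `^ a)%:E <=
    (L * (2 ^+ N + 4 `^ `|a| * 4 ^+ N / (lam - 1)) * lam ^+ j)%:E)%E.
Proof.
move=> mt tL lam1 hlam.
have L0 : 0 <= L by rewrite -lee_fin -tL measure_ge0.
set C0 := 4 `^ `|a| * 4 ^+ N.
have C00 : 0 <= C0 by rewrite mulr_ge0 ?powR_ge0 ?exprn_ge0.
have lam10 : 0 < lam - 1 by rewrite subr_gt0.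
elim: j => [|j ih].
  apply: (@le_trans _ _ (1 * (L * (2 * 1) ^+ N))%:E).
    apply: shell_integral_le => //.
      by move=> q /=; rewrite !in_itv/= expr1n expr0 => /andP[].
    by move=> q /=; rewrite in_itv/= expr0 -eq_le => /eqP <-; rewrite powR1.
  by rewrite lee_fin mul1r expr0 !mulr1 mulrDr lerDl mulr_ge0// divr_ge0// ltW.
have mf : measurable_fun setT (fun z : spacetime => (nsq z.2 `^ a)%:E).
  apply/measurable_EFinP; apply: (measurableT_comp (f := (@powR R)^~ a)); first exact: measurable_powR.
  exact: (measurableT_comp measurable_nsq measurable_snd).
have p4 (i : nat) : 1 <= (4 : R) ^+ i by rewrite exprn_ege1// ler1n.
have le4 : (4 : R) ^+ j <= 4 ^+ j.+1 by rewrite exprS ler_peMl// ?exprn_ge0// ler1n.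
have -> : shell t `[1, (4 ^+ j.+1)] = shell t `[1, (4 ^+ j)] `|` shell t `](4 ^+ j), (4 ^+ j.+1)].
  apply/seteqP; split => -[r x] /=; rewrite /shell /= !in_itv/=.
    move=> [tr /andP[h1 h2]]; case: (leP (nsq x) (4 ^+ j)) => h; [left|right];
      by split=> //=; rewrite ?h1 ?h.
  case=> -[tr /andP[h1 h2]]; split => //=; first by rewrite h1 (le_trans h2).
  by rewrite h2 (le_trans (p4 j) (ltW h1)).
rewrite ge0_integral_setU//=.
- have h2 : (\int[vol]_(z in shell t `](4 ^+ j)%R, (4 ^+ j.+1)%R]) (nsq z.2 `^ a)%:E <=
      (4 `^ `|a| * (4 `^ a) ^+ j * (L * (2 * 2 ^+ j.+1) ^+ N))%:E)%E.
    apply: shell_integral_le => //.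
    + move=> q /=; rewrite !in_itv/= => /andP[_ h].
      by rewrite -exprM mulnC exprM -natrX.
    + move=> q /=; rewrite in_itv/= => /andP[/ltW h3 h4]; exact: powR_dyadic_le.
  apply: (le_trans (leeD ih h2)); rewrite -EFinD lee_fin.
  have -> : 4 `^ `|a| * (4 `^ a) ^+ j * (L * (2 * 2 ^+ j.+1) ^+ N) =
      L * (C0 * (4 `^ a * 2 ^+ N) ^+ j).
    have -> : 2 * 2 ^+ j.+1 = 4 * 2 ^+ j :> R by rewrite exprS; ring.
    by rewrite /C0 !exprMn -!exprM [(N * j)%N]mulnC; ring.
  have h3 : (4 `^ a * 2 ^+ N) ^+ j <= lam ^+ j.
    by rewrite lerXn2r ?nnegrE// ?mulr_ge0 ?powR_ge0 ?exprn_ge0// ltW// (lt_trans ltr01).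
  have h4 : L * (C0 * (4 `^ a * 2 ^+ N) ^+ j) <= L * (C0 * lam ^+ j).
    by rewrite ler_wpM2l// ler_wpM2l.
  have h5 : 0 <= L * 2 ^+ N * lam ^+ j * (lam - 1).
    by rewrite !mulr_ge0 ?exprn_ge0 ?(ltW lam10)// ltW// (lt_trans ltr01).
  have h6 : L * (2 ^+ N + C0 / (lam - 1)) * lam ^+ j.+1 -
     L * (2 ^+ N + C0 / (lam - 1)) * lam ^+ j =
     L * 2 ^+ N * lam ^+ j * (lam - 1) + L * (C0 * lam ^+ j).
    by rewrite exprS; field; rewrite gt_eqF.
  lra.
- exact: measurable_shell.
- exact: measurable_shell.
- exact: measurable_funS mf.
- by move=> z _; rewrite lee_fin powR_ge0.
- apply/disj_setPS => -[s x] /= [[_ +] [_ +]]; rewrite /= !in_itv/=.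
  by move=> /andP[_ h1] /andP[h2 _]; move: (lt_le_trans h2 h1); rewrite ltxx.
Qed.

End layers.

(** * Support and measurability of the test functions *)

Lemma far_from_center {R : realType} (t r : R) : 0 < r -> t \notin `[r, 3 * r] ->
  r <= `|t - 2 * r|.
Proof.
move=> r0; rewrite in_itv/= negb_and -!ltNge => /orP[h|h].
  by rewrite ler0_norm; lra.
by rewrite ger0_norm; lra.
Qed.

Section test_support.
Context {R : realType} {N : nat}.
Local Notation spacetime := (measurableTypeR R * 'rV[R]_N)%type.
Variables (k : R) (b : bool) (n j : nat).
Hypothesis hk : 2 - N%:R < k.

Local Notation rho := ((4 : R) ^+ j).
Local Notation phi := (@test R N k b n rho).

(** A compact set outside of which the test function vanishes. In space it is
slightly larger than the support, 1 + 4^j <= 4^(j+1), in order to be a union of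
dyadic shells. *)
Definition slab : set spacetime := @shell R N [set` `[rho, 3 * rho]] `[1, 4 ^+ j.+1].

Lemma rho_ge1 : 1 <= rho.
Proof. by rewrite exprn_ege1// ler1n. Qed.

Let rho0 : 0 < rho. Proof. exact: lt_le_trans rho_ge1. Qed.

Lemma Omega_shell : @Omega R N = shell [set` `]0, +oo[] `[1, +oo[.
Proof.
apply/seteqP; split => -[t x] [/= ht hx]; split => //=.
  by rewrite in_itv/= andbT; exact: (Omega_nsq (conj ht hx : Omega (t, x))).
move: hx; rewrite /= in_itv/= andbT -enorm_nsq => hx; apply/negP; rewrite -leNgt.
by rewrite -(ler_pXn2r (n := 2))// ?nnegrE ?sqrtr_ge0// expr1n.
Qed.

Lemma measurable_Omega : measurable (@Omega R N).
Proof. by rewrite Omega_shell; exact: measurable_shell. Qed.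

Lemma measurable_slab : measurable slab.
Proof. exact: measurable_shell. Qed.

Lemma slab_Omega : slab `<=` Omega.
Proof.
rewrite Omega_shell => -[t x] [/=]; rewrite !in_itv/= => /andP[h1 _] /andP[h2 _].
by split; rewrite /= in_itv/= andbT// (lt_le_trans rho0).
Qed.

Lemma slab_duration : @lebesgue_measure R [set` `[rho, 3 * rho]] = (2 * rho)%:E.
Proof.
rewrite lebesgue_measure_itv/= lte_fin ltr_pMl// ltr1n.
by rewrite -EFinB; congr (_%:E); ring.
Qed.

Lemma cutoff_off_slab z : Omega z -> ~ slab z -> cutoff rho z = 0.
Proof.
rewrite Omega_shell => -[/= ht]; rewrite in_itv/= andbT => q1 nK; rewrite /cutoff.
have [ht1|ht1] := boolP (z.1 \in `[rho, 3 * rho]); last first.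
  by rewrite (hat_out rho0) ?mul0r//; exact: far_from_center.
rewrite (hat_out (c := 1) rho0) ?mulr0//.
have [hq|hq] := leP (nsq z.2) (4 ^+ j.+1).
  by exfalso; apply: nK; split => //=; rewrite in_itv/= q1 hq.
have h := rho_ge1; move: hq; rewrite exprS => hq.
have hr : rho <= nsq z.2 - 1 by move: hq h; move: (_ ^+ _) (nsq _) => r q; lra.
by rewrite ger0_norm// (le_trans _ hr)// ltW.
Qed.

Lemma continuous_nsq_snd : continuous (fun z : spacetime => nsq z.2).
Proof.
move=> z; apply: (@continuous_comp _ _ _ (fun w : spacetime => w.2) (@nsq R N)).
  exact: cvg_snd.
exact: continuous_nsq.
Qed.

Lemma closed_slab : closed slab.
Proof.
have -> : slab = (fun z : spacetime => z.1 : R) @^-1` [set` `[rho, 3 * rho]] `&`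
   (fun z : spacetime => nsq z.2) @^-1` [set` `[1, 4 ^+ j.+1]] by [].
apply: closedI; apply: preimage_closed; try exact: itv_closed.
- by move=> z _; exact: cvg_fst.
- by move=> z _; exact: continuous_nsq_snd.
Qed.

Lemma compact_slab : compact slab.
Proof.
apply: (subclosed_compact closed_slab (B := [set` `[rho, 3 * rho]] `*`
    [set x : 'rV[R]_N | forall i, [set` `[- 2 ^+ j.+1, 2 ^+ j.+1]] (x ord0 i)])).
  apply: compact_setX; first exact: segment_compact.
  by apply: (@rV_compact R N (fun=> [set` `[- 2 ^+ j.+1, 2 ^+ j.+1]])) => i; exact: segment_compact.
move=> z [/= h1]; rewrite in_itv/= => /andP[_ h2]; split => //= i.
rewrite in_itv/= -ler_norml -(ler_pXn2r (n := 2))// ?nnegrE ?exprn_ge0//.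
rewrite real_normK ?num_real// -exprM mulnC exprM -natrX.
apply: le_trans h2; rewrite /nsq (bigD1 i)//= lerDl.
by apply: sumr_ge0 => l _; exact: sqr_ge0.
Qed.

Lemma compactly_supported_test : compactly_supported Omega phi.
Proof.
have sub : support_in Omega phi `<=` slab.
  rewrite /support_in (closure_id slab).1; last exact: closed_slab.
  apply: closure_subset => z [zO /= nz]; apply: contrapT => /(cutoff_off_slab zO) h.
  by move/eqP: nz; apply; rewrite testE h exprS mul0r mul0r.
split; last by move=> z /sub /slab_Omega.
exact: (subclosed_compact (@closed_closure _ _) compact_slab sub).
Qed.

Lemma measurable_hats c m :
  [/\ measurable_fun setT (hat c rho m), measurable_fun setT (hat1 c rho m) &
      measurable_fun setT (hat2 c rho m)].
Proof.
by split; apply: continuous_measurable_fun;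
  [exact: continuous_hat|exact: continuous_hat1|exact: continuous_hat2].
Qed.

Lemma measurable_profile : measurable_fun setT (profile k N%:R b).
Proof.
apply: measurable_funB; first exact: measurable_powR.
by apply: measurable_funM => //; exact: measurable_powR.
Qed.

Lemma measurable_profile1 : measurable_fun setT (profile1 k N%:R b).
Proof.
apply: measurable_funB; first by apply: measurable_funM => //; exact: measurable_powR.
by do 2! apply: measurable_funM => //; exact: measurable_powR.
Qed.

Lemma measurable_time (g : R -> R) : measurable_fun setT g ->
  measurable_fun setT (fun z : spacetime => g z.1).
Proof. by move=> mg; exact: (measurableT_comp mg measurable_fst). Qed.

Lemma measurable_radial (g : R -> R) : measurable_fun setT g ->
  measurable_fun setT (fun z : spacetime => g (nsq z.2)).
Proof.
move=> mg; apply: (measurableT_comp mg).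
exact: (measurableT_comp measurable_nsq measurable_snd).
Qed.

Lemma measurable_test : measurable_fun setT phi.
Proof.
apply: measurable_funM; first by apply: measurable_time; have [] := measurable_hats (2 * rho) n.+4.
apply: measurable_radial; apply: measurable_funM; first exact: measurable_profile.
by have [] := measurable_hats 1 n.+4.
Qed.

Lemma measurable_dt_test : measurable_fun setT (dt phi).
Proof.
rewrite (_ : dt phi = fun z => hat1 (2 * rho) rho n.+4 z.1 *
    (profile k N%:R b (nsq z.2) * hat 1 rho n.+4 (nsq z.2))); last first.
  by apply/funext => z; rewrite dt_test//; exact: rho_ge1.
apply: measurable_funM; first by apply: measurable_time; have [] := measurable_hats (2 * rho) n.+4.
apply: (measurable_radial (g := fun q => profile k N%:R b q * hat 1 rho n.+4 q)).
apply: measurable_funM; first exact: measurable_profile.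
by have [] := measurable_hats 1 n.+4.
Qed.

Lemma measurable_adjoint_op_test : measurable_fun Omega (adjoint_op k phi).
Proof.
have [mY mY1 mY2] := measurable_hats 1 n.+4.
have [mA _ _] := measurable_hats (2 * rho) n.+4.
have mH := measurable_profile; have mH1 := measurable_profile1.
pose g q := 8 * (q * profile1 k N%:R b q * hat1 1 rho n.+4 q)
     + 4 * (q * (profile k N%:R b q * hat2 1 rho n.+4 q))
     + 2 * (N%:R - k) * (profile k N%:R b q * hat1 1 rho n.+4 q).
have mg : measurable_fun setT g.
  apply: measurable_funD; [apply: measurable_funD|];
  by do ! apply: measurable_funM => //.
apply: (@eq_measurable_fun _ _ _ _ _
    (fun z : spacetime => - (hat (2 * rho) rho n.+4 z.1 * g (nsq z.2)))).
  by move=> z /set_mem zO; rewrite adjoint_op_test//; exact: rho_ge1.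
apply: measurable_funTS.
have m : measurable_fun setT (fun z : spacetime => hat (2 * rho) rho n.+4 z.1 * g (nsq z.2)).
  by apply: measurable_funM; [exact: measurable_time|exact: measurable_radial].
exact: measurable_funN m.
Qed.

End test_support.

(** * The energy estimate *)

Section energy_estimate.
Context {R : realType} {N : nat}.
Local Notation spacetime := (measurableTypeR R * 'rV[R]_N)%type.
Variables (k sigma alpha p : R) (b : bool) (n j : nat).
Hypothesis hk : 2 - N%:R < k.
Hypothesis p1 : 1 < p.
Hypothesis alpha0 : alpha <= 0.
Hypothesis hn : 2 / (p - 1) <= n.+2%:R.

Local Notation rho := ((4 : R) ^+ j).
Local Notation phi := (@test R N k b n rho).
Local Notation r := ((p - 1)^-1).
Local Notation K := (@slab R N j).
Local Notation C := (@test_cst R N k n).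

(** The remainder of Young's inequality is a power of time, which is bounded by
its value at the final time [3 * rho] of the slab, times the power of |x|^2 that
comes from the weight |x|^sigma and from the bound |x|^k of the profile. *)
Definition error_exp : R := (k - sigma * r) / 2.

Definition error_cst : R := (C / rho) `^ (1 + r) * (3 * rho) `^ (- (alpha * r)).

Definition error_term : spacetime -> R :=
  (fun z => error_cst * nsq z.2 `^ error_exp) \_ K.

Let rho0 : 0 < rho. Proof. by rewrite exprn_gt0. Qed.
Let rho1 : 1 <= rho. Proof. exact: rho_ge1. Qed.
Let C0 : 0 < C. Proof. exact: test_cst_gt0. Qed.

Definition weight (z : spacetime) : R := z.1 `^ alpha * enorm z.2 `^ sigma.

Lemma enorm_powR (x : 'rV[R]_N) (a : R) : enorm x `^ a = nsq x `^ (a / 2).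
Proof.
by rewrite -enorm_nsq -powR_mulrn ?sqrtr_ge0// -powRrM mulrC divfK.
Qed.

Lemma slab_time z : K z -> rho <= z.1 <= 3 * rho.
Proof. by move=> [/=]; rewrite in_itv. Qed.

Lemma slab_nsq z : K z -> 1 <= nsq z.2 <= 4 ^+ j.+1.
Proof. by move=> [_ /=]; rewrite in_itv. Qed.

Lemma slab_powR_le z (a : R) : K z -> nsq z.2 `^ a <= (4 ^+ j.+1) `^ `|a|.
Proof.
move=> /slab_nsq/andP[h1 h2]; apply: (@le_trans _ _ (nsq z.2 `^ `|a|)).
  by rewrite ler_powR// ler_norm.
by apply: ge0_ler_powR; rewrite ?nnegrE ?nsq_ge0// exprn_ge0.
Qed.

Lemma error_cst_ge0 : 0 <= error_cst.
Proof. by rewrite mulr_ge0 ?powR_ge0. Qed.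

Lemma cutoff_itv (z : spacetime) : 0 <= cutoff rho z <= 1.
Proof.
have /andP[h1 h2] := hat_base (2 * rho) rho z.1.
have /andP[h3 h4] := hat_base 1 rho (nsq z.2).
by rewrite mulr_ge0//= mulr_ile1.
Qed.

Lemma error_pointwise (u : spacetime -> R) z : Omega z ->
  `|u z| * (`|dt phi z| + `|adjoint_op k phi z|) <=
  weight z * phi z * `|u z| `^ p + error_term z.
Proof.
move=> zO; have le_der := derivatives_test_le b n hk rho1 zO.
have H0 : 0 <= profile k N%:R b (nsq z.2) by apply: profile_ge0 => //; exact: Omega_nsq.
have [zK|zK] := pselect (K z); last first.
  have Z0 := cutoff_off_slab zO zK.
  have -> : `|dt phi z| + `|adjoint_op k phi z| = 0.
    apply/eqP; rewrite eq_le addr_ge0// andbT; apply: (le_trans le_der).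
    by rewrite Z0 exprS !mul0r mulr0.
  rewrite testE Z0 exprS !mul0r !mulr0 !mul0r add0r /error_term patchE.
  by rewrite memNset.
have /andP[t1 t2] := slab_time zK; have /andP[q1 q2] := slab_nsq zK.
have t0 : (0 : R) < z.1 by exact: lt_le_trans t1.
have q0 : 0 < nsq z.2 by exact: lt_le_trans q1.
have w0 : 0 < weight z by rewrite /weight enorm_powR mulr_gt0 ?powR_gt0.
apply: (@le_trans _ _ (`|u z| * (C / rho * (cutoff rho z ^+ n.+2 * profile k N%:R b (nsq z.2))))).
  by rewrite ler_wpM2l.
apply: (le_trans (young_cutoff p1 w0 (divr_gt0 C0 rho0) (cutoff_itv z) H0 (normr_ge0 _) hn)).
rewrite -testE lerD2l /error_term patchE mem_set// /error_cst -!mulrA.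
rewrite ler_wpM2l ?powR_ge0//.
have -> : weight z `^ (- r) = (z.1 : R) `^ (- (alpha * r)) * nsq z.2 `^ (- (sigma * r / 2)).
  rewrite /weight enorm_powR powRM ?powR_ge0// -!powRrM.
  by congr (_ `^ _ * _ `^ _); ring.
rewrite -mulrA; apply: ler_pM; rewrite ?powR_ge0 ?mulr_ge0 ?powR_ge0//.
  apply: ge0_ler_powR; rewrite ?nnegrE ?(ltW t0) ?mulr_ge0 ?(ltW rho0)//.
  by rewrite oppr_ge0 mulr_le0_ge0// invr_ge0 subr_ge0 ltW.
rewrite [leRHS](_ : _ = nsq z.2 `^ (- (sigma * r / 2)) * nsq z.2 `^ (k / 2)).
  by rewrite ler_wpM2l ?powR_ge0//; exact: profile_le.
rewrite -powRD ?(gt_eqF q0) ?implybT//; congr (_ `^ _).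
by rewrite /error_exp; ring.
Qed.

Lemma measurable_weight : measurable_fun setT weight.
Proof.
apply: measurable_funM.
  by apply: (measurable_time (g := fun t => t `^ alpha)); exact: measurable_powR.
rewrite (_ : (fun _ => _) = (fun z : spacetime => nsq z.2 `^ (sigma / 2))).
  by apply: (measurable_radial (g := fun q => q `^ (sigma / 2))); exact: measurable_powR.
by apply/funext => z; rewrite enorm_powR.
Qed.

Lemma measurable_error_term : measurable_fun setT error_term.
Proof.
apply/measurable_restrict => //; first exact: measurable_slab.
rewrite setTI; apply: measurable_funTS; apply: measurable_funM => //.
by apply: (measurable_radial (g := fun q => q `^ error_exp)); exact: measurable_powR.
Qed.

Lemma slab_bounded : exists M : R, forall z, K z ->
  [/\ `|weight z * phi z| <= M, `|error_term z| <= M,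
      `|dt phi z| <= M & `|adjoint_op k phi z| <= M].
Proof.
pose Q (a : R) : R := (4 ^+ j.+1) `^ `|a|.
have Q0 a : 0 <= Q a by exact: powR_ge0.
pose M1 := rho `^ alpha * Q (sigma / 2) * Q (k / 2).
pose M2 := error_cst * Q error_exp.
pose M3 := C / rho * Q (k / 2).
have M10 : 0 <= M1 by rewrite !mulr_ge0 ?powR_ge0.
have M20 : 0 <= M2 by rewrite mulr_ge0 ?error_cst_ge0.
have M30 : 0 <= M3 by rewrite mulr_ge0// divr_ge0// ltW.
exists (M1 + M2 + M3) => z zK.
have zO := slab_Omega zK.
have le_der := derivatives_test_le b n hk rho1 zO.
have /andP[t1 t2] := slab_time zK; have /andP[q1 q2] := slab_nsq zK.
have t0 : (0 : R) < z.1 by exact: lt_le_trans t1.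
have q0 : 0 < nsq z.2 by exact: lt_le_trans q1.
have H0 : 0 <= profile k N%:R b (nsq z.2) by exact: profile_ge0.
have HQ : profile k N%:R b (nsq z.2) <= Q (k / 2).
  by apply: (le_trans (profile_le _ _ _ _)); exact: slab_powR_le.
have /andP[Z0 Z1] := cutoff_itv z.
have ZH m : cutoff rho z ^+ m * profile k N%:R b (nsq z.2) <= Q (k / 2).
  by apply: le_trans HQ; rewrite ler_piMl// exprn_ile1.
have der3 : `|dt phi z| + `|adjoint_op k phi z| <= M3.
  by apply: (le_trans le_der); rewrite ler_wpM2l// divr_ge0// ltW.
split.
- apply: (@le_trans _ _ M1); last by rewrite -addrA lerDl addr_ge0.
  rewrite normrM /weight enorm_powR ger0_norm ?mulr_ge0 ?powR_ge0//.
  rewrite (ger0_norm (test_ge0 b n rho hk zO)) testE.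
  apply: ler_pM; last exact: ZH.
  - by apply: mulr_ge0; exact: powR_ge0.
  - by apply: mulr_ge0 => //; exact: exprn_ge0.
  apply: ler_pM; rewrite ?powR_ge0//; last exact: slab_powR_le.
  rewrite -[alpha]opprK 2!(powRN _ (- alpha)) lef_pV2 ?posrE ?powR_gt0//.
  by apply: ge0_ler_powR; rewrite ?nnegrE ?oppr_ge0// ltW.
- apply: (@le_trans _ _ M2); last by rewrite addrAC lerDr addr_ge0.
  rewrite /error_term patchE mem_set// ger0_norm ?mulr_ge0 ?error_cst_ge0 ?powR_ge0//.
  by rewrite ler_wpM2l ?error_cst_ge0//; exact: slab_powR_le.
- apply: (@le_trans _ _ M3); last by rewrite lerDr addr_ge0.
  by apply: le_trans der3; rewrite lerDl.
- apply: (@le_trans _ _ M3); last by rewrite lerDr addr_ge0.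
  by apply: le_trans der3; rewrite lerDr.
Qed.

Lemma slab_finite : (@volume R N K < +oo)%E.
Proof.
apply: (@le_lt_trans _ _ ((2 * rho) * (2 * 2 ^+ j.+1) ^+ N)%:E); last exact: ltry.
apply: shell_volume_le => //; first exact: slab_duration.
move=> q /=; rewrite !in_itv/= => /andP[_ h].
by rewrite -exprM mulnC exprM -natrX.
Qed.

Lemma error_integral_le (lam : R) : 1 < lam -> 4 `^ error_exp * 2 ^+ N <= lam ->
  \int[volume]_(z in Omega) error_term z <=
  error_cst * (2 * rho * (2 ^+ N + 4 `^ `|error_exp| * 4 ^+ N / (lam - 1)) * lam ^+ j.+1).
Proof.
move=> lam1 hlam; rewrite /error_term.
have h := @dyadic_integral_le R N _ (2 * rho) error_exp lam j.+1
  (measurable_itv `[rho, 3 * rho]) (slab_duration j) lam1 hlam.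
rewrite -Rintegral_mkcondr setIidr; last exact: slab_Omega.
set B := 2 * rho * _ * _ in h *.
rewrite /Rintegral.
have -> : (\int[volume]_(z in K) (error_cst * nsq z.2 `^ error_exp)%:E =
   error_cst%:E * \int[volume]_(z in K) (nsq z.2 `^ error_exp)%:E)%E.
  under eq_integral do rewrite EFinM.
  rewrite ge0_integralZl//.
  - exact: measurable_slab.
  - apply/measurable_EFinP; apply: measurable_funTS.
    by apply: (measurable_radial (g := fun q => q `^ error_exp)); exact: measurable_powR.
  - by move=> z _; rewrite lee_fin powR_ge0.
  - by rewrite lee_fin error_cst_ge0.
have I0 : (0 <= \int[volume]_(z in K) (nsq z.2 `^ error_exp)%:E)%E.
  by apply: integral_ge0 => z _; rewrite lee_fin powR_ge0.
have Ifin : (\int[volume]_(z in K) (nsq z.2 `^ error_exp)%:E \is a fin_num)%E.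
  by rewrite ge0_fin_numE//; apply: (le_lt_trans h); exact: ltry.
rewrite fineM//= ler_wpM2l ?error_cst_ge0//.
by rewrite -lee_fin fineK.
Qed.

(** The right-hand side of the weak inequality exceeds its first term by at most a
quantity that does not depend on the solution. *)
Lemma energy_estimate (u : spacetime -> R) (lam : R) : Lp_loc p Omega u ->
  1 < lam -> 4 `^ error_exp * 2 ^+ N <= lam ->
  - (\int[volume]_(z in Omega) (u z * dt phi z))
    + \int[volume]_(z in Omega) (adjoint_op k phi z * u z) <=
  \int[volume]_(z in Omega)
     (z.1 `^ alpha * enorm z.2 `^ sigma * `|u z| `^ p * phi z)
  + error_cst * (2 * rho * (2 ^+ N + 4 `^ `|error_exp| * 4 ^+ N / (lam - 1)) * lam ^+ j.+1).
Proof.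
move=> [mu_ loc] lam1 hlam; have [M hM] := slab_bounded.
apply: (@le_trans _ _ (\int[volume]_(z in Omega) (weight z * phi z * `|u z| `^ p)
   + \int[volume]_(z in Omega) error_term z)); last first.
  apply: lerD; last exact: error_integral_le.
  rewrite le_eqVlt; apply/orP; left; apply/eqP; apply: eq_Rintegral => z _.
  by rewrite /weight; ring.
apply: (@integral_absorption _ _ _ _ _ K u p p1 _ _ _ _ _ _ _ _ _ _ M) => //.
- exact: measurable_Omega.
- exact: measurable_slab.
- exact: slab_Omega.
- exact: slab_finite.
- exact: (loc K (@slab_Omega R N j) (@compact_slab R N j)).
- apply: measurable_funTS; apply: measurable_funM; first exact: measurable_weight.
  exact: measurable_test.
- by apply: measurable_funTS; exact: measurable_error_term.
- by apply: measurable_funTS; exact: measurable_dt_test.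
- exact: measurable_adjoint_op_test.
- move=> z zO zK; have le_der := derivatives_test_le b n hk rho1 zO.
  have Z0 := cutoff_off_slab zO zK.
  rewrite Z0 exprS !mul0r mulr0 in le_der.
  split.
  + by rewrite testE Z0 exprS !mul0r mulr0.
  + by rewrite /error_term patchE memNset.
  + apply/eqP; rewrite -normr_le0; apply: le_trans le_der; by rewrite lerDl.
  + apply/eqP; rewrite -normr_le0; apply: le_trans le_der; by rewrite lerDr.
- by move=> z zO; exact: error_pointwise.
Qed.

End energy_estimate.

(** * The boundary term *)

Section boundary_integral.
Context {R : realType} {N : nat}.
Local Notation spacetime := (measurableTypeR R * 'rV[R]_N)%type.
Variables (n : nat) (rho : R).
Hypothesis rho0 : 0 < rho.

Local Notation A := (hat (2 * rho) rho n.+4).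
Local Notation time := ([set` `]0, +oo[] : set (measurableTypeR R)).

Lemma integrable_time_factor :
  (@lebesgue_measure R).-integrable time (EFin \o A).
Proof.
apply: (@integrable_dominated _ (measurableTypeR R) R (@lebesgue_measure R) time
  [set` `[rho, 3 * rho]] (fun=> 0) 2 _ _ _ _ _ _ 1).
- exact: measurable_itv.
- exact: measurable_itv.
- by move=> t /=; rewrite !in_itv/= andbT => /andP[h _]; exact: lt_le_trans h.
- change (@lebesgue_measure R ([set` `[rho, (3 * rho)%R]] : set R) < +oo)%E.
  by rewrite lebesgue_measure_itv/=; case: ifP => _; rewrite -?EFinB ltry.
- by [].
- under eq_integral do rewrite normr0 powR0//.
  by rewrite integral0.
- by apply: measurable_funTS; apply: continuous_measurable_fun; exact: continuous_hat.
- by move=> t _ ht; rewrite hat_out//; apply: far_from_center => //; apply/negP.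
- move=> t _; rewrite ger0_norm ?hat_ge0// mul1r normr0 powR0// addr0.
  exact: hat_le1.
Qed.

Lemma time_integral_ge : (3 / 4) ^+ n.+4 * rho <= \int[@lebesgue_measure R]_(t in time) A t.
Proof.
(* On the middle half of its support the bump is at least a power of 3/4. *)
have len : @lebesgue_measure R [set` `[3 / 2 * rho, 5 / 2 * rho]] = rho%:E.
  rewrite lebesgue_measure_itv/= lte_fin ltr_pM2r// ifT; last by lra.
  by rewrite -EFinB; congr (_%:E); field.
pose J' : set (measurableTypeR R) := [set` `[3 / 2 * rho, 5 / 2 * rho]].
have mJ : measurable J' by exact: measurable_itv.
have Jlen : @lebesgue_measure R J' = rho%:E by exact: len.
have mT : measurable time by exact: measurable_itv.
have JT : J' `<=` time.
  by move=> t; rewrite /J' /= !in_itv/= andbT => /andP[h _]; rewrite (lt_le_trans _ h)// mulr_gt0.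
have -> : (3 / 4) ^+ n.+4 * rho = \int[@lebesgue_measure R]_(t in time) ((fun=> (3 / 4) ^+ n.+4 : R) \_ J') t.
  by rewrite -Rintegral_mkcondr setIidr// Rintegral_cst//; congr (_ * _); rewrite -[LHS]/(fine rho%:E) -Jlen.
apply: le_Rintegral.
- exact: measurable_itv.
- rewrite -restrict_EFin; apply/integrable_restrict => //.
  rewrite setIidr//; apply: measurable_bounded_integrable => //.
    by move: Jlen => /= ->; rewrite ltry.
  exact: bounded_cst.
- exact: integrable_time_factor.
- move=> t _; rewrite patchE; case: ifPn => [/set_mem|_]; last exact: hat_ge0.
  rewrite /J' /= in_itv/= => /andP[h1 h2]; apply: hat_in => //.
  by rewrite ler_norml; apply/andP; split; lra.
Qed.

Lemma measurable_unit_sphere : measurable (@unit_sphere R N).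
Proof.
have -> : @unit_sphere R N = @enorm R N @^-1` [set 1] by [].
by rewrite -[X in measurable X]setTI; apply: measurable_enorm.
Qed.

Lemma boundary_integralE (f : 'rV[R]_N -> R) (g : spacetime -> R) (c : R) :
  (@sphere_measure R N).-integrable unit_sphere (EFin \o f) ->
  (forall z, Gamma z -> g z = A z.1 * c) ->
  \int[area]_(z in Gamma) (f z.2 * g z) =
  \int[@lebesgue_measure R]_(t in time) A t *
    \int[@sphere_measure R N]_(x in unit_sphere) f x * c.
Proof.
move=> hf hg; rewrite (@eq_Rintegral _ _ _ _ _ (fun z : spacetime => A z.1 * (f z.2 * c))); last first.
  by move=> z /set_mem /hg ->; ring.
have mS := measurable_unit_sphere.
rewrite -mulrA -(RintegralZr c mS hf).
apply: Rintegral_prod => //.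
- exact: integrable_time_factor.
- apply: (@eq_integrable _ _ _ _ _ mS ((EFin \o f) \* cst c%:E)%E).
    by move=> x _.
  exact: (integrableZr mS c hf).
Qed.

End boundary_integral.

(** * Letting the scale tend to infinity *)

Section contradiction.
Context {R : realType} {N : nat}.
Local Notation spacetime := (measurableTypeR R * 'rV[R]_N)%type.
Variables (k sigma alpha p : R) (b : bool).
Hypothesis hk : 2 - N%:R < k.
Hypothesis p1 : 1 < p.
Hypothesis halpha : -1 <= alpha <= 0.
Hypothesis hp2 : p < 1 + (sigma + 2 * (alpha + 1)) / (N%:R + k - 2).

Local Notation r := ((p - 1)^-1).

(** Equal to (p + alpha) / (p - 1), the exponent of the negative power of the
scale in [error_cst]. *)
Definition decay_exp : R := 1 + r + alpha * r.

Lemma geometric_small (c D x : R) : 0 <= x < 1 -> 0 < c ->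
  exists j, D * x ^+ j < c.
Proof.
move=> /andP[x0 x1] c0.
have h : (fun j => D * x ^+ j) @ \oo --> D * 0.
  by apply: cvgM; [exact: cvg_cst|apply: cvg_expr; rewrite ger0_norm].
rewrite mulr0 in h.
have [j _ hj] := cvgr_lt _ h _ c0.
by exists j; apply: hj => /=.
Qed.

(** This is the bound on [p], multiplied out: growth of the remainder over the
dyadic shells against decay of its constant. *)
Lemma subcritical : 4 `^ error_exp k sigma p * 2 ^+ N < 4 `^ decay_exp.
Proof.
have pm : 0 < p - 1 by rewrite subr_gt0.
have r0 : 0 < r by rewrite invr_gt0.
have -> : (2 : R) ^+ N = 4 `^ (N%:R / 2).
  have -> : (4 : R) = 2 ^+ 2 by rewrite -natrX.
  by rewrite -(powR_mulrn 2)// -powRrM mulrC divfK// powR_mulrn.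
rewrite -powRD ?(gt_eqF (ltr0n _ _)) ?implybT ?pnatr_eq0 ?implybT//.
rewrite /powR pnatr_eq0 /= ltr_expR ltr_pM2r ?ln_gt0 ?ltr1n//.
have d0 : 0 < N%:R + k - 2 by move: hk; lra.
have h1 : (p - 1) * (N%:R + k - 2) < sigma + 2 * (alpha + 1).
  by rewrite -ltr_pdivlMr// ltrBlDl.
have h2 : N%:R + k - 2 < (sigma + 2 * (alpha + 1)) * r.
  by rewrite ltr_pdivlMr// mulrC.
rewrite /error_exp /decay_exp; lra.
Qed.

Lemma decay_gt1 : 1 < 4 `^ decay_exp.
Proof.
have r0 : 0 < r by rewrite invr_gt0 subr_gt0.
rewrite /powR pnatr_eq0 /= expR_gt1 mulr_gt0 ?ln_gt0 ?ltr1n//.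
have : 0 <= (alpha + 1) * r by rewrite mulr_ge0 ?(ltW r0)//; move/andP: halpha => []; lra.
rewrite /decay_exp; lra.
Qed.

(** The weak inequality and the energy estimate bound [kappa], up to a constant
factor, by [(lam / Lam) ^+ j] for every [j]: the boundary term and the bound for
the remainder are both proportional to the duration of the test function. *)
Lemma no_solution (kappa : R) (u : spacetime -> R) : 0 < kappa ->
  Lp_loc p Omega u ->
  (forall n j, let phi := test k b n (4 ^+ j) in
     kappa * ((3 / 4) ^+ n.+4 * 4 ^+ j)
     + \int[volume]_(z in Omega)
       (z.1 `^ alpha * enorm z.2 `^ sigma * `|u z| `^ p * phi z)
     <= - (\int[volume]_(z in Omega) (u z * dt phi z))
       + \int[volume]_(z in Omega) (adjoint_op k phi z * u z)) -> False.
Proof.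
move=> kappa0 hu weak; have /andP[am a0] := halpha.
have pm : 0 < p - 1 by rewrite subr_gt0.
have r0 : 0 < r by rewrite invr_gt0.
have [n hn] : exists n : nat, 2 / (p - 1) <= n.+2%:R.
  exists (Num.bound (2 / (p - 1))).
  have : 2 / (p - 1) < (Num.bound (2 / (p - 1)))%:R by rewrite archi_boundP// divr_ge0// ltW.
  by move/ltW/le_trans; apply; rewrite ler_nat; exact: leqW (leqnSn _).
pose Lam : R := 4 `^ decay_exp.
(* Strictly between 1 and [Lam], and above the growth of the shells. *)
pose lam := Num.max (4 `^ error_exp k sigma p * 2 ^+ N) ((1 + Lam) / 2).
have Lam1 : 1 < Lam by exact: decay_gt1.
have lam1 : 1 < lam by rewrite lt_max; apply/orP; right; lra.
have lamLam : lam < Lam by rewrite gt_max subcritical /=; lra.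
have hlam : 4 `^ error_exp k sigma p * 2 ^+ N <= lam by rewrite le_max lexx.
have lam0 : 0 < lam by exact: lt_trans lam1.
have Lam0 : 0 < Lam by exact: lt_trans Lam1.
pose Kc : R := 2 ^+ N + 4 `^ `|error_exp k sigma p| * 4 ^+ N / (lam - 1).
pose C := @test_cst R N k n.
have C0 : 0 < C by exact: test_cst_gt0.
pose D := C `^ (1 + r) * 3 `^ (- (alpha * r)) * (2 * Kc * lam).
have [j hj] : exists j, D * (lam / Lam) ^+ j < kappa * (3 / 4) ^+ n.+4.
  apply: geometric_small; last by rewrite mulr_gt0// exprn_gt0//; lra.
  by rewrite divr_ge0 ?ltW//= ltr_pdivrMr// mul1r.
have := energy_estimate b j hk p1 a0 hn hu lam1 hlam.
have := weak n j; rewrite /= => h1 h2; have {h1 h2} := le_trans h1 h2.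
rewrite addrC lerD2l -/Kc => h; move: hj; rewrite ltNge => /negP; apply.
have rho0 : 0 < (4 : R) ^+ j by rewrite exprn_gt0.
set rho := (4 : R) ^+ j in rho0 *.
have rhoD : rho `^ decay_exp = Lam ^+ j by rewrite /rho powR_expn.
have e : @error_cst R N k alpha p n j =
    C `^ (1 + r) * 3 `^ (- (alpha * r)) * (Lam ^+ j)^-1.
  rewrite /error_cst -/C -/rho -rhoD (powRM _ (ltW C0)) ?invr_ge0 ?(ltW rho0)//.
  rewrite (powRM _ (ler0n _ 3) (ltW rho0)) -(powR_inv1 (ltW rho0)) -(powRrM rho) mulN1r.
  have -> : (rho `^ decay_exp)^-1 = rho `^ (- (1 + r)) * rho `^ (- (alpha * r)).
    by rewrite -powRN /decay_exp -powRD ?(gt_eqF rho0) ?implybT// -opprD.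
  by ring.
rewrite e in h; rewrite -(ler_pM2r rho0) -mulrA; apply: (le_trans h).
rewrite le_eqVlt; apply/orP; left; apply/eqP.
rewrite /D exprS expr_div_n -/rho; field.
by rewrite expf_neq0// gt_eqF.
Qed.

End contradiction.

(** * Nonexistence *)

Lemma neumann_test_test {R : realType} {N : nat} (k : R) (n j : nat) : 2 - N%:R < k ->
  neumann_test k (@test R N k false n (4 ^+ j)).
Proof.
move=> hk; have rho1 := @rho_ge1 R j; split.
- exact: C12_test.
- exact: test_ge0.
- exact: compactly_supported_test.
- move=> z zG; rewrite normal_derivative_test// test_Gamma//.
  by rewrite mul0r !subr0; ring.
Qed.

Lemma dirichlet_test_test {R : realType} {N : nat} (k : R) (n j : nat) : 2 - N%:R < k ->
  dirichlet_test (@test R N k true n (4 ^+ j)).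
Proof.
move=> hk; have rho1 := @rho_ge1 R j; split.
- exact: C12_test.
- exact: test_ge0.
- exact: compactly_supported_test.
- by move=> z zG; rewrite test_Gamma// subrr mulr0.
- move=> z zG; rewrite normal_derivative_test// oppr_le0 mulr_ge0 ?hat_ge0//.
  by rewrite mul1r subr_ge0 ltW.
Qed.

Theorem theorem1p4 (R : realType) (N : nat) (hN : (2 <= N)%N)
    (k sigma : R) (f : 'rV[R]_N -> R)
    (hf : (@sphere_measure R N).-integrable unit_sphere (EFin \o f))
    (If_gt0 : 0 < \int[@sphere_measure R N]_(x in unit_sphere) f x)
    (alpha : R) (halpha : -1 <= alpha <= 0)
    (hsigma : 0 < sigma + 2 * (alpha + 1))
    (hk : 2 - N%:R < k)
    (p : R) (hp1 : 1 < p)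
    (hp2 : p < 1 + (sigma + 2 * (alpha + 1)) / (N%:R + k - 2)) :
  (~ exists u, neumann_weak_solution alpha sigma k p f u) /\
  (~ exists u, dirichlet_weak_solution alpha sigma k p f u).
Proof.
split=> -[u [hu weak]].
- apply: (@no_solution R N k sigma alpha p false hk hp1 halpha hp2 _ u If_gt0 hu).
  move=> n j /=; set phi := test k false n (4 ^+ j).
  have rho1 := @rho_ge1 R j; have rho0 : 0 < (4 : R) ^+ j by exact: lt_le_trans rho1.
  apply: le_trans (weak phi (neumann_test_test n j hk)).
  rewrite addrC lerD2l.
  rewrite (@boundary_integralE R N n (4 ^+ j) rho0 f phi 1 hf); last first.
    by move=> z zG; rewrite /phi test_Gamma// subr0.
  by rewrite mulr1 mulrC ler_wpM2r ?(ltW If_gt0)//; exact: time_integral_ge.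
- (* The normal derivative of the profile is [- (k - (2 - N))] on the sphere. *)
  have hk0 : 0 < k - (2 - N%:R) by rewrite subr_gt0.
  apply: (@no_solution R N k sigma alpha p true hk hp1 halpha hp2 _ u (mulr_gt0 If_gt0 hk0) hu).
  move=> n j /=; set psi := test k true n (4 ^+ j).
  have rho1 := @rho_ge1 R j; have rho0 : 0 < (4 : R) ^+ j by exact: lt_le_trans rho1.
  apply: le_trans (weak psi (dirichlet_test_test n j hk)).
  rewrite addrC lerD2l.
  rewrite (@boundary_integralE R N n (4 ^+ j) rho0 f _ (- (k - (2 - N%:R))) hf); last first.
    by move=> z zG; rewrite /psi normal_derivative_test// mul1r mulrN.
  rewrite mulrN opprK -[leRHS]mulrA [leRHS]mulrC.
  rewrite ler_wpM2l ?(ltW (mulr_gt0 If_gt0 hk0))//.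
  exact: time_integral_ge.
Qed.
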